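(* Suppose that for graphs with $O(n)$ vertices there is an incremental distance sensitivity oracle with $\tilde{O}(n^2)$ space, $\tilde{O}(n^3)$ preprocessing time, worst-case $\tilde{O}(n^2)$ update time per edge insertion, and $\tilde{O}(1)$ query time. Then it can be transformed into an offline fully dynamic distance sensitivity oracle such that, starting from a graph with $O(n)$ vertices, if the total number of updates (edge insertions and deletions) is $T=O(n)$, the total preprocessing and update time is $\tilde{O}(n^3)$ and the query time is $\tilde{O}(1)$.
   Context: A (1-failure) distance sensitivity oracle for a weighted graph $G$ returns, given vertices $u,v$ and an edge $f$, the length of the shortest $u$-$v$ path in $G$ with $f$ removed. An incremental oracle supports edge insertions; an offline fully dynamic oracle supports a sequence of edge insertions and deletions that is known in advance, answering queries for the current graph. $\tilde{O}(\cdot)$ hides polylogarithmic factors in $n$. *)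

(* Defs.v *)
From HB Require Import structures.
From mathcomp Require Import all_boot all_order all_algebra.

Set Implicit Arguments.
Unset Strict Implicit.
Unset Printing Implicit Defensive.

Import Order.TTheory GRing.Theory Num.Theory.

(** * Word RAM with unit costs

    Time, space and programs refer to a deterministic word RAM.  For word size
    [w] a word is a natural number below [2 ^ w].  A program has registers and
    an addressable memory, both indexed by natural numbers; since a program
    mentions finitely many registers, only the memory is an unbounded resource.
    Control flow is structured (conditionals and loops).  A program does not
    depend on [w] nor on the input size. *)

Inductive binop :=
  OpAdd | OpSub | OpMul | OpDiv | OpMod
| OpAnd | OpOr | OpXor | OpShl | OpShr | OpLt | OpEq.

Inductive expr :=
| Const of nat
| Reg of nat
| Peek of expr
| Bin of binop & expr & expr.

Inductive cmd :=
| Skip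
| Assign of nat & expr
| Poke of expr & expr
| Seq of cmd & cmd
| If of expr & cmd & cmd
| While of expr & cmd.

(** [(registers, memory)] *)
Definition state : Type := (nat -> nat) * (nat -> nat).

Definition set_cell (f : nat -> nat) (i x : nat) : nat -> nat :=
  fun j => if j == i then x else f j.

(** [x] and [y] are words. *)
Definition bin_sem (w : nat) (o : binop) (x y : nat) : nat :=
  match o with
  | OpAdd => x + y
  | OpSub => x + (2 ^ w - y)
  | OpMul => x * y
  | OpDiv => x %/ y
  | OpMod => x %% y
  | OpAnd => Nat.land x y
  | OpOr => Nat.lor x y
  | OpXor => Nat.lxor x y
  | OpShl => x * 2 ^ y
  | OpShr => x %/ 2 ^ y
  | OpLt => x < y
  | OpEq => x == y
  end %% 2 ^ w.

Fixpoint eval (w : nat) (s : state) (e : expr) : nat :=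
  match e with
  | Const k => k %% 2 ^ w
  | Reg r => s.1 r
  | Peek a => s.2 (eval w s a)
  | Bin o a b => bin_sem w o (eval w s a) (eval w s b)
  end.

Fixpoint esize (e : expr) : nat :=
  match e with
  | Const _ | Reg _ => 1
  | Peek a => (esize a).+1
  | Bin _ a b => (esize a + esize b).+1
  end.

(** Least number exceeding every address read while evaluating [e]. *)
Fixpoint espan (w : nat) (s : state) (e : expr) : nat :=
  match e with
  | Const _ | Reg _ => 0
  | Peek a => maxn (eval w s a).+1 (espan w s a)
  | Bin _ a b => maxn (espan w s a) (espan w s b)
  end.

(** [exec w c s s' t m]: started in [s], the program [c] halts in [s'] after
    [t] steps, and [m] is the least number exceeding every memory address it
    reads or writes. *)
Inductive exec (w : nat) : cmd -> state -> state -> nat -> nat -> Prop :=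
| exec_skip s : exec w Skip s s 1 0
| exec_assign r e s :
    exec w (Assign r e) s (set_cell s.1 r (eval w s e), s.2)
      (esize e).+1 (espan w s e)
| exec_poke a e s :
    exec w (Poke a e) s (s.1, set_cell s.2 (eval w s a) (eval w s e))
      (esize a + esize e).+1
      (maxn (eval w s a).+1 (maxn (espan w s a) (espan w s e)))
| exec_seq c1 c2 s1 s2 s3 t1 t2 m1 m2 :
    exec w c1 s1 s2 t1 m1 -> exec w c2 s2 s3 t2 m2 ->
    exec w (Seq c1 c2) s1 s3 (t1 + t2) (maxn m1 m2)
| exec_if e c1 c2 s s' t m :
    exec w (if eval w s e != 0 then c1 else c2) s s' t m ->
    exec w (If e c1 c2) s s' ((esize e).+1 + t) (maxn (espan w s e) m)
| exec_while_stop e c s :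
    eval w s e = 0 ->
    exec w (While e c) s s (esize e).+1 (espan w s e)
| exec_while_step e c s1 s2 s3 t1 t2 m1 m2 :
    eval w s1 e <> 0 ->
    exec w c s1 s2 t1 m1 -> exec w (While e c) s2 s3 t2 m2 ->
    exec w (While e c) s1 s3 ((esize e).+1 + t1 + t2)
      (maxn (espan w s1 e) (maxn m1 m2)).

(** Finite data in registers or memory; all other cells hold [0]. *)
Definition cells (l : seq nat) : nat -> nat := nth 0 l.

(** Two's complement. *)
Definition word_of_int (w : nat) (z : int) : nat :=
  `|(z %% (2 ^ w)%:Z)%Z|.

(** [f n] is soft-O of [g n]; the successor keeps the polylogarithmic factor
    nonzero at [n = 1]. *)
Definition soft_O (f g : nat -> nat) : Prop :=
  exists a b : nat, forall n : nat, 0 < n ->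
    f n <= a * g n * (trunc_log 2 n).+1 ^ b.

(** * Weighted graphs

    The vertices are ['I_N]; [G (u, v)] is the weight of the edge from [u] to
    [v], or [None] if there is none.  Undirected graphs are the symmetric ones,
    and every operation on an edge then acts on both orientations. *)

Definition wgraph (N : nat) := {ffun 'I_N * 'I_N -> option int}.

Definition edge (N : nat) (G : wgraph N) : rel 'I_N := fun u v => G (u, v).

Fixpoint walk_length (N : nat) (G : wgraph N) (u : 'I_N) (p : seq 'I_N) : int :=
  if p is v :: q then (odflt 0 (G (u, v)) + walk_length G v q)%R else 0%R.

Definition is_path (N : nat) (G : wgraph N) (u v : 'I_N) (p : seq 'I_N) : Prop :=
  [/\ path (edge G) u p, uniq (u :: p) & last u p = v].

(** [None] stands for infinite distance. *)
Definition is_distance (N : nat) (G : wgraph N) (u v : 'I_N)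
    (d : option int) : Prop :=
  match d with
  | Some l =>
      (exists2 p, is_path G u v p & walk_length G u p = l) /\
      (forall p, is_path G u v p -> (l <= walk_length G u p)%R)
  | None => forall p, ~ is_path G u v p
  end.

Definition set_edge (directed : bool) (N : nat) (G : wgraph N) (x y : 'I_N)
    (o : option int) : wgraph N :=
  [ffun e => if (e == (x, y)) || ~~ directed && (e == (y, x)) then o else G e].

(** Loopless graphs with weights in [W] and without negative closed walks.
    The size condition makes every path length representable in one word. *)
Definition admissible (directed : bool) (W : pred int) (w N : nat)
    (G : wgraph N) : Prop :=
  [/\ forall u, G (u, u) = None,
      ~~ directed -> forall u v, G (u, v) = G (v, u),
      forall u v z, G (u, v) = Some z -> W z /\ `|z|%N * N < 2 ^ w.-1
    & forall u p, path (edge G) u p -> last u p = u ->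
        (0 <= walk_length G u p)%R].

Inductive update (N : nat) :=
| Insert of 'I_N & 'I_N & int
| Delete of 'I_N & 'I_N.

Definition apply_update (directed : bool) (N : nat) (G : wgraph N) (a : update N) :
    wgraph N :=
  match a with
  | Insert x y z => set_edge directed G x y (Some z)
  | Delete x y => set_edge directed G x y None
  end.

(** Only absent edges are inserted and only present edges are deleted. *)
Definition legal (directed : bool) (W : pred int) (w N : nat) (G : wgraph N)
    (a : update N) : Prop :=
  match a with
  | Insert x y _ => ~~ edge G x y
  | Delete x y => edge G x y
  end /\ admissible directed W w (apply_update directed G a).

Fixpoint legal_seq (directed : bool) (W : pred int) (w N : nat) (G : wgraph N)
    (us : seq (update N)) : Prop :=
  if us is a :: us' then
    legal directed W w G a /\ legal_seq directed W w (apply_update directed G a) us'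
  else True.

(** * Input and output conventions *)

(** Row-major adjacency matrix, two words (presence flag, weight) per entry. *)
Definition graph_words (w N : nat) (G : wgraph N) : seq nat :=
  flatten [seq if G (u, v) is Some z then [:: 1; word_of_int w z]
               else [:: 0; 0] | u <- enum 'I_N, v <- enum 'I_N].

Definition update_words (w N : nat) (a : update N) : seq nat :=
  match a with
  | Insert x y z => [:: 1; nat_of_ord x; nat_of_ord y; word_of_int w z]
  | Delete x y => [:: 0; nat_of_ord x; nat_of_ord y; 0]
  end.

Definition insert_args (w N : nat) (x y : 'I_N) (z : int) : seq nat :=
  [:: nat_of_ord x; nat_of_ord y; word_of_int w z].

Definition query_args (N : nat) (u v x y : 'I_N) : seq nat :=
  [:: nat_of_ord u; nat_of_ord v; nat_of_ord x; nat_of_ord y].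

(** Register [0] tells whether the distance is finite, register [1] holds it. *)
Definition answers (w : nat) (r : nat -> nat) (d : option int) : Prop :=
  match d with
  | Some l => r 0 = 1 /\ r 1 = word_of_int w l
  | None => r 0 = 0
  end.

(** [r] holds the length of a shortest [u]-[v] path in [G] without the edge
    [(x, y)]. *)
Definition correct_answer (directed : bool) (w N : nat) (G : wgraph N)
    (u v x y : 'I_N) (r : nat -> nat) : Prop :=
  exists2 d, is_distance (set_edge directed G x y None) u v d & answers w r d.

(** * Distance sensitivity oracles

    The state of an oracle between operations is the memory; each operation
    starts with its arguments in the first registers. *)

Record oracle := Oracle { preprocess : cmd; do_update : cmd; query : cmd }.

(** Memory contents [m] the oracle may have when the current graph is [G],
    after any interleaving of insertions and queries. *)
Inductive inc_reach (directed : bool) (W : pred int) (A : oracle) (w n N : nat) :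
    wgraph N -> (nat -> nat) -> Prop :=
| inc_preprocess G r m t s :
    admissible directed W w G ->
    exec w (preprocess A) (cells [:: n; N], cells (graph_words w G)) (r, m) t s ->
    inc_reach directed W A w n G m
| inc_insert G m x y z r m' t s :
    inc_reach directed W A w n G m ->
    legal directed W w G (Insert x y z) ->
    exec w (do_update A) (cells (insert_args w x y z), m) (r, m') t s ->
    inc_reach directed W A w n (apply_update directed G (Insert x y z)) m'
| inc_query G m u v x y r m' t s :
    inc_reach directed W A w n G m ->
    edge G x y ->
    exec w (query A) (cells (query_args u v x y), m) (r, m') t s ->
    inc_reach directed W A w n G m'.

(** An incremental oracle for graphs with at most [C * n] vertices, correct for
    all word sizes of at least some constant times [log n].  The space bound
    [sp] governs the data structure, i.e. the memory used by updates and
    queries; preprocessing may use as much scratch memory as it has time. *)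
Definition incremental_oracle (directed : bool) (W : pred int) (C : nat) : Prop :=
  exists (A : oracle) (c : nat) (sp tp tu tq : nat -> nat),
  [/\ soft_O sp (fun n => n ^ 2), soft_O tp (fun n => n ^ 3),
      soft_O tu (fun n => n ^ 2), soft_O tq (fun=> 1)
    & forall n w N : nat,
        0 < n -> c * (trunc_log 2 n).+1 <= w -> N <= C * n ->
      [/\ forall G : wgraph N, admissible directed W w G ->
            exists r m t s,
            [/\ exec w (preprocess A)
                  (cells [:: n; N], cells (graph_words w G)) (r, m) t s,
                t <= tp n & s <= tp n],
          forall (G : wgraph N) m x y z,
            inc_reach directed W A w n G m ->
            legal directed W w G (Insert x y z) ->
            exists r m' t s,
            [/\ exec w (do_update A) (cells (insert_args w x y z), m)
                  (r, m') t s,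
                t <= tu n & s <= sp n]
        & forall (G : wgraph N) m u v x y,
            inc_reach directed W A w n G m -> edge G x y ->
            exists r m' t s,
            [/\ exec w (query A) (cells (query_args u v x y), m) (r, m') t s,
                t <= tq n, s <= sp n & correct_answer directed w G u v x y r]]].

Definition off_input (w n N : nat) (G : wgraph N) (us : seq (update N)) : state :=
  (cells [:: n; N; size us],
   cells (graph_words w G ++ flatten [seq update_words w a | a <- us])).

(** [off_reach A w n G us k m tau]: starting from [G] with the sequence [us]
    known in advance, [m] is a possible memory content after the first [k]
    updates, interleaved with any queries to the current graphs, and [tau] is
    the time spent so far on preprocessing and updates. *)
Inductive off_reach (directed : bool) (A : oracle) (w n N : nat)
    (G : wgraph N) (us : seq (update N)) : nat -> (nat -> nat) -> nat -> Prop :=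
| off_preprocess r m t s :
    exec w (preprocess A) (off_input w n G us) (r, m) t s ->
    off_reach directed A w n G us 0 m t
| off_update k m tau r m' t s :
    off_reach directed A w n G us k m tau ->
    k < size us ->
    exec w (do_update A) (cells [::], m) (r, m') t s ->
    off_reach directed A w n G us k.+1 m' (tau + t)
| off_query k m tau u v x y r m' t s :
    off_reach directed A w n G us k m tau ->
    edge (foldl (apply_update directed (N:=N)) G (take k us)) x y ->
    exec w (query A) (cells (query_args u v x y), m) (r, m') t s ->
    off_reach directed A w n G us k m' tau.

(** An offline fully dynamic oracle for graphs with at most [C * n] vertices
    and at most [D * n] updates. *)
Definition offline_oracle (directed : bool) (W : pred int) (C D : nat) : Prop :=
  exists (A : oracle) (c : nat) (tt tq : nat -> nat),
  [/\ soft_O tt (fun n => n ^ 3), soft_O tq (fun=> 1)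
    & forall (n w N : nat) (G : wgraph N) (us : seq (update N)),
        0 < n -> c * (trunc_log 2 n).+1 <= w -> N <= C * n ->
        size us <= D * n ->
        admissible directed W w G -> legal_seq directed W w G us ->
      [/\ exists r m t s,
            exec w (preprocess A) (off_input w n G us) (r, m) t s,
          forall k m tau, off_reach directed A w n G us k m tau -> tau <= tt n,
          forall k m tau, off_reach directed A w n G us k m tau ->
            k < size us ->
            exists r m' t s, exec w (do_update A) (cells [::], m) (r, m') t s
        & forall k m tau u v x y, off_reach directed A w n G us k m tau ->
            let Gk := foldl (apply_update directed (N:=N)) G (take k us) in
            edge Gk x y ->
            exists r m' t s,
            [/\ exec w (query A) (cells (query_args u v x y), m) (r, m') t s,
                t <= tq n & correct_answer directed w Gk u v x y r]]].

(* Main.v *)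
Require Import Defs.
From mathcomp Require Import all_boot all_order all_algebra.
From mathcomp Require Import zify.

Set Implicit Arguments.
Unset Strict Implicit.
Unset Printing Implicit Defensive.

Import Order.TTheory GRing.Theory Num.Theory.

(** The offline oracle keeps one copy of the incremental data structure for
    every point in time and does all the work during preprocessing.  Call an
    edge stable on an interval of times if it is present and not updated there.
    The incremental oracle is first preprocessed on the edges that are never
    updated; then intervals are halved repeatedly: the structure of each half
    is a copy of the structure of the whole interval into which the newly
    stable edges are inserted.  Those were updated inside the larger interval,
    so a level of the recursion costs [O(T)] insertions and [O(T)] copies of a
    structure of size [~O(n^2)], and there are [O(log T)] levels.  The programs
    of the incremental oracle run on a window of the memory; an access bound of
    [~O(n^2)] cells is what makes copying a window enough. *)

(** * The word RAM *)

(** Once all structures exist, an offline update only advances the address of the current slot, so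
    deletions never reach the incremental oracle. Each insertion must be legal for it: the edge is
    absent and the new graph admissible. Every graph on the way to a half is a subgraph of the graph
    at the first time of that half, and subgraphs inherit admissibility, in particular the absence
    of negative closed walks. Absence of the edge is why an edge updated several times is treated
    only at its first update inside the larger interval. No graph is stored per interval: whether an
    edge is stable, and with which weight, is found by replaying all updates, in [O(T)] steps, which
    is within the [~O(n^2)] allowed for an insertion. Queries may change the memory of the
    incremental oracle, so a slot is only required to hold some memory reachable for its graph. The
    programs cannot evaluate the space bound, an arbitrary function; slots get the explicit length
    that its soft-O bound provides. *)

Lemma exec_det w c s s1 s2 t1 t2 k1 k2 :
  exec w c s s1 t1 k1 -> exec w c s s2 t2 k2 -> s1 = s2 /\ t1 = t2.
Proof.
move=> E; elim: E s2 t2 k2 => {c s s1 t1 k1}.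
- by move=> s s2 t2 k2 E; inversion E; subst.
- by move=> r e s s2 t2 k2 E; inversion E; subst.
- by move=> a e s s2 t2 k2 E; inversion E; subst.
- move=> c1 c2 s1 s2 s3 t1 t2 m1 m2 _ IH1 _ IH2 s' t' k' E; inversion E; subst.
  match goal with H : exec w c1 _ _ _ _ |- _ => case: (IH1 _ _ _ H) => ? ? end; subst.
  by match goal with H : exec w c2 _ _ _ _ |- _ => case: (IH2 _ _ _ H) => ? ? end; subst.
- move=> e c1 c2 s s' t m _ IH s2 t2 k2 E; inversion E; subst.
  by match goal with H : exec w _ _ _ _ _ |- _ => case: (IH _ _ _ H) => ? ? end; subst.
- by move=> e c s H s2 t2 k2 E; inversion E; subst.
- move=> e c s1 s2 s3 t1 t2 m1 m2 H _ IH1 _ IH2 s' t' k' E; inversion E; subst => //.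
  match goal with H : exec w c _ _ _ _ |- _ => case: (IH1 _ _ _ H) => ? ? end; subst.
  by match goal with H : exec w (While e c) _ _ _ _ |- _ => case: (IH2 _ _ _ H) => ? ? end; subst.
Qed.

(** * Relocating a program into a window of memory *)

Notation own := 23 (only parsing).

(** The first register after the four arguments of a query, so that the base can be set before the
    arguments are passed on. *)
Notation base_reg := 4 (only parsing).

Fixpoint ereg (e : expr) : nat :=
  match e with
  | Const _ => 0
  | Reg r => r.+1
  | Peek a => ereg a
  | Bin _ a b => maxn (ereg a) (ereg b)
  end.

Fixpoint creg (c : cmd) : nat :=
  match c with
  | Skip => 0
  | Assign r e => maxn r.+1 (ereg e)
  | Poke a e => maxn (ereg a) (ereg e)
  | Seq c1 c2 => maxn (creg c1) (creg c2)
  | If e c1 c2 => maxn (ereg e) (maxn (creg c1) (creg c2))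
  | While e c => maxn (ereg e) (creg c)
  end.

Fixpoint ereloc (e : expr) : expr :=
  match e with
  | Const k => Const k
  | Reg r => Reg (own + r)
  | Peek a => Peek (Bin OpAdd (ereloc a) (Reg base_reg))
  | Bin o a b => Bin o (ereloc a) (ereloc b)
  end.

(* The program [c] on the memory window starting at the address in [base_reg],
   with its registers moved out of the way of the first [own] registers. *)
Fixpoint reloc (c : cmd) : cmd :=
  match c with
  | Skip => Skip
  | Assign r e => Assign (own + r) (ereloc e)
  | Poke a e => Poke (Bin OpAdd (ereloc a) (Reg base_reg)) (ereloc e)
  | Seq c1 c2 => Seq (reloc c1) (reloc c2)
  | If e c1 c2 => If (ereloc e) (reloc c1) (reloc c2)
  | While e c => While (ereloc e) (reloc c)
  end.

(** Only memory reads grow, each by the addition and the register of the base; this is the origin of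
    the slowdown factor 3. *)
Lemma esize_ereloc e : (esize (ereloc e)).+2 <= 3 * esize e.
Proof. by elim: e => //= [a|_ a IHa b] IH; lia. Qed.

Section Relocation.

Variables (w R M base : nat).
Hypothesis base_bound : base + M <= 2 ^ w.

Definition mirrors (s s' : state) : Prop :=
  [/\ s'.1 base_reg = base,
      forall i, i < R -> s'.1 (own + i) = s.1 i
    & forall a, a < M -> s'.2 (base + a) = s.2 a].

(** The bound on [espan] serves twice: the cell read lies in the mirrored window, and by
    [base_bound] adding the base does not wrap around modulo [2 ^ w]. *)
Lemma eval_ereloc s s' e :
  mirrors s s' -> ereg e <= R -> espan w s e <= M ->
  eval w s' (ereloc e) = eval w s e.
Proof.
move=> [Hb Hr Hm]; elim: e => [k|r|a IH|o a IHa b IHb] /=.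
- by [].
- by move=> rR _; apply: Hr.
- rewrite geq_max => aR /andP[aM sM]; rewrite IH // Hb /bin_sem addnC.
  by rewrite modn_small; [exact: Hm | lia].
- by rewrite !geq_max => /andP[aR bR] /andP[aM bM]; rewrite IHa // IHb.
Qed.

Lemma eval_poke_addr s s' e :
  mirrors s s' -> ereg e <= R -> espan w s e <= M -> eval w s e < M ->
  eval w s' (Bin OpAdd (ereloc e) (Reg base_reg)) = base + eval w s e.
Proof.
move=> ms eR eM lM; rewrite /= (eval_ereloc ms) //; case: ms => -> _ _; rewrite /bin_sem.
by rewrite addnC modn_small //; lia.
Qed.

(** Since [k] bounds every address accessed, a state known on [M] cells only is enough to follow the
    run. The last two conclusions are the frame property that protects the registers of the caller
    and the other slots. *)
Lemma exec_reloc c s1 s2 t k s1' :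
  exec w c s1 s2 t k -> creg c <= R -> k <= M -> mirrors s1 s1' ->
  exists s2' t' k', [/\ exec w (reloc c) s1' s2' t' k', t' <= 3 * t,
    mirrors s2 s2', forall i, i < own -> s2'.1 i = s1'.1 i
    & forall b, ~~ (base <= b < base + M) -> s2'.2 b = s1'.2 b].
Proof.
move=> E; elim: E s1' => {c s1 s2 t k}.
- move=> s s' _ _ ms; exists s', 1, 0; split=> //; exact: exec_skip.
- move=> r e s s'; rewrite /= !geq_max => /andP[rR eR] kM ms.
  have ev := eval_ereloc ms eR kM.
  eexists _, _, _; split; first exact: exec_assign.
  + by have := esize_ereloc e; lia.
  + case: ms => Hb Hr Hm; split=> //= i iR; rewrite /set_cell ev.
    by rewrite eqn_add2l; case: eqP => // _; apply: Hr.
  + by move=> i iO; rewrite /= /set_cell ifN //; lia.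
  + by [].
- move=> a e s s'; rewrite /= !geq_max => /andP[aR eR] /and3P[aM saM seM] ms.
  have ev := eval_ereloc ms eR seM.
  have ea := eval_poke_addr ms aR saM aM.
  eexists _, _, _; split; first exact: exec_poke.
  + have := esize_ereloc e; have := esize_ereloc a; rewrite /=; lia.
  + case: ms => Hb Hr Hm; rewrite ea ev.
    split=> //= b bM; rewrite /set_cell eqn_add2l.
    by case: eqP => // _; apply: Hm.
  + by [].
  + move=> b bM; rewrite ea /= /set_cell ifN //.
    by apply: contra bM => /eqP ->; rewrite leq_addr ltn_add2l.
- move=> c1 c2 s1 s2 s3 t1 t2 m1 m2 _ IH1 _ IH2 s1'.
  rewrite /= !geq_max => /andP[c1R c2R] /andP[m1M m2M] ms.
  have [s2' [t1' [k1' [E1 T1 ms2 R1 M1]]]] := IH1 _ c1R m1M ms.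
  have [s3' [t2' [k2' [E2 T2 ms3 R2 M2]]]] := IH2 _ c2R m2M ms2.
  exists s3'; eexists _, _; split; first exact: (exec_seq E1 E2).
  + by lia.
  + by [].
  + by move=> i iO; rewrite R2 // R1.
  + by move=> b bM; rewrite M2 // M1.
- move=> e c1 c2 s s' t m _ IH s1'.
  rewrite /= !geq_max => /and3P[eR c1R c2R] /andP[seM mM] ms.
  have ev := eval_ereloc ms eR seM.
  have [|s2' [t2 [k2 [E T ms2 R2 M2]]]] := IH _ _ mM ms; first by case: ifP.
  exists s2'; eexists _, _; split; first by
    apply: exec_if; rewrite ev; move: E; rewrite (fun_if reloc); apply.
  + by have := esize_ereloc e; lia.
  + by [].
  + by [].
  + by [].
- move=> e c s H s1'; rewrite /= !geq_max => /andP[eR cR] kM ms.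
  have ev := eval_ereloc ms eR kM.
  exists s1'; eexists _, _; split; first by apply: exec_while_stop; rewrite ev.
  + by have := esize_ereloc e; lia.
  + by [].
  + by [].
  + by [].
- move=> e c s1 s2 s3 t1 t2 m1 m2 H _ IH1 _ IH2 s1'.
  rewrite /= !geq_max => /andP[eR cR] /and3P[seM m1M m2M] ms.
  have ev := eval_ereloc ms eR seM.
  have [s2' [t1' [k1' [E1 T1 ms2 R1 M1]]]] := IH1 _ cR m1M ms.
  have whR : creg (While e c) <= R by rewrite /= geq_max eR.
  have [s3' [t2' [k2' [E2 T2 ms3 R2 M2]]]] := IH2 _ whR m2M ms2.
  exists s3'; eexists _, _; split.
  + by apply: (exec_while_step _ E1 E2); rewrite ev.
  + by have := esize_ereloc e; lia.
  + by [].
  + by move=> i iO; rewrite R2 // R1.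
  + by move=> b bM; rewrite M2 // M1.
Qed.

End Relocation.

(* Exact natural number semantics of the expressions used below; [safe P]
   says that no operation over- or underflows for words below [P]. *)
Fixpoint value (l : seq nat) (m : nat -> nat) (e : expr) : nat :=
  match e with
  | Const k => k
  | Reg r => nth 0 l r
  | Peek a => m (value l m a)
  | Bin o a b =>
      match o with
      | OpAdd => value l m a + value l m b
      | OpSub => value l m a - value l m b
      | OpMul => value l m a * value l m b
      | OpDiv => value l m a %/ value l m b
      | OpMod => value l m a %% value l m b
      | OpLt => value l m a < value l m b
      | OpEq => value l m a == value l m b
      | _ => 0
      end
  end.

Fixpoint safe (P : nat) (l : seq nat) (m : nat -> nat) (e : expr) : Prop :=
  match e with
  | Const k => k < P
  | Reg r => r < own
  | Peek a => safe P l m a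
  | Bin o a b =>
      safe P l m a /\ safe P l m b /\
      match o with
      | OpAdd => value l m a + value l m b < P
      | OpSub => value l m b <= value l m a < P
      | OpMul => value l m a * value l m b < P
      | OpDiv | OpMod => value l m a < P
      | OpLt | OpEq => 1 < P
      | _ => False
      end
  end.

Lemma eval_value w r l m e :
  (forall i, i < own -> r i = nth 0 l i) -> safe (2 ^ w) l m e ->
  eval w (r, m) e = value l m e.
Proof.
move=> rl; elim: e => [k|i|a IH|o a IHa b IHb] /=.
- exact: modn_small.
- exact: rl.
- by move=> /IH ->.
- move=> [/IHa -> [/IHb -> H]]; rewrite /bin_sem; case: o H => //= H.
  + exact: modn_small.
  + have -> : value l m a + (2 ^ w - value l m b) = value l m a - value l m b + 2 ^ w by lia.
    by rewrite modnDr modn_small //; lia.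
  + exact: modn_small.
  + by rewrite modn_small // (leq_ltn_trans (leq_div _ _)).
  + by rewrite modn_small // (leq_ltn_trans (leq_mod _ _)).
  + by rewrite modn_small // (leq_ltn_trans (leq_b1 _)).
  + by rewrite modn_small // (leq_ltn_trans (leq_b1 _)).
Qed.

(** * Hoare logic for total correctness with time bounds *)

Section ProgramLogic.

Variable w : nat.
Let P := 2 ^ w.

Implicit Types (l : seq nat) (m : nat -> nat) (Q : seq nat -> (nat -> nat) -> Prop).

(** Only the first [own] registers are described, by a list padded with zeros; the others belong to
    relocated programs and may hold anything before and after. *)
Definition runs (c : cmd) l m (T : nat) Q : Prop :=
  forall r, (forall i, i < own -> r i = nth 0 l i) ->
  exists r' m' t k l',
    [/\ exec w c (r, m) (r', m') t k, t <= T,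
        forall i, i < own -> r' i = nth 0 l' i & Q l' m'].

Lemma runs_le c l m T T' Q : T <= T' -> runs c l m T Q -> runs c l m T' Q.
Proof.
move=> TT' H r /H [r' [m' [t [k [l' [? ? ? ?]]]]]].
by exists r', m', t, k, l'; split=> //; lia.
Qed.

Lemma runs_skip l m T Q : 0 < T -> Q l m -> runs Skip l m T Q.
Proof.
move=> T0 q r rl; exists r, m; eexists _, _, l.
by split; [exact: exec_skip|..].
Qed.

Lemma runs_assign x e l m T Q :
  safe P l m e -> (esize e).+1 <= T -> Q (set_nth 0 l x (value l m e)) m ->
  runs (Assign x e) l m T Q.
Proof.
move=> se tT q r rl; eexists _, _, _, _, (set_nth 0 l x (value l m e)).
split; first exact: exec_assign.
- by [].
- move=> i iO; rewrite /= /set_cell (eval_value rl se) nth_set_nth /=.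
  by case: eqP => // _; apply: rl.
- exact: q.
Qed.

Lemma runs_poke a e l m T Q :
  safe P l m a -> safe P l m e -> (esize a + esize e).+1 <= T ->
  Q l (set_cell m (value l m a) (value l m e)) -> runs (Poke a e) l m T Q.
Proof.
move=> sa se tT q r rl; eexists _, _, _, _, l; split; first exact: exec_poke.
- by [].
- exact: rl.
- by rewrite /= (eval_value rl sa) (eval_value rl se).
Qed.

Lemma runs_seq T1 Q1 c1 c2 l m T Q :
  runs c1 l m T1 Q1 -> T1 <= T ->
  (forall l' m', Q1 l' m' -> runs c2 l' m' (T - T1) Q) ->
  runs (Seq c1 c2) l m T Q.
Proof.
move=> H1 TT H2 r /H1 [r1 [m1 [t1 [k1 [l1 [E1 ? rl1 /H2 H]]]]]].
have [r2 [m2 [t2 [k2 [l2 [E2 ? ? ?]]]]]] := H _ rl1.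
exists r2, m2; eexists _, _, l2; split; [exact: (exec_seq E1 E2)|lia|by []..].
Qed.

Lemma runs_assign_seq x e c l m T Q :
  safe P l m e -> (esize e).+1 <= T ->
  runs c (set_nth 0 l x (value l m e)) m (T - (esize e).+1) Q ->
  runs (Seq (Assign x e) c) l m T Q.
Proof.
move=> se tT H.
apply: (@runs_seq (esize e).+1
  (fun l' m' => l' = set_nth 0 l x (value l m e) /\ m' = m)) => //.
  exact: runs_assign.
by move=> _ _ [-> ->].
Qed.

Lemma runs_poke_seq a e c l m T Q :
  safe P l m a -> safe P l m e -> (esize a + esize e).+1 <= T ->
  runs c l (set_cell m (value l m a) (value l m e)) (T - (esize a + esize e).+1) Q ->
  runs (Seq (Poke a e) c) l m T Q.
Proof.
move=> sa se tT H.
apply: (@runs_seq (esize a + esize e).+1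
  (fun l' m' => l' = l /\ m' = set_cell m (value l m a) (value l m e))) => //.
  exact: runs_poke.
by move=> _ _ [-> ->].
Qed.

Lemma runs_if e c1 c2 l m T Q :
  safe P l m e -> (esize e).+1 <= T ->
  (value l m e != 0 -> runs c1 l m (T - (esize e).+1) Q) ->
  (value l m e = 0 -> runs c2 l m (T - (esize e).+1) Q) ->
  runs (If e c1 c2) l m T Q.
Proof.
move=> se tT H1 H2 r rl.
have H : runs (if eval w (r, m) e != 0 then c1 else c2) l m (T - (esize e).+1) Q.
  rewrite (eval_value rl se); case: eqP => [/H2 //|/eqP]; exact: H1.
have [r' [m' [t [k [l' [E ? ? ?]]]]]] := H _ rl.
exists r', m'; eexists _, _, l'; split; [exact: exec_if E|lia|by []..].
Qed.

(** The invariant is indexed by the number of iterations still to come, so one induction yields both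
    termination and the time bound. *)
Lemma runs_while (Inv : nat -> seq nat -> (nat -> nat) -> Prop) (c0 : nat)
    e c k l m T Q :
  (forall k l m, Inv k l m -> safe P l m e) ->
  (forall l m, Inv 0 l m -> value l m e = 0) ->
  (forall k l m, Inv k.+1 l m -> value l m e <> 0 /\ runs c l m c0 (Inv k)) ->
  Inv k l m -> k * (c0 + (esize e).+1) + (esize e).+1 <= T ->
  (forall l' m', Inv 0 l' m' -> Q l' m') ->
  runs (While e c) l m T Q.
Proof.
move=> Is I0 IS + + IQ; elim: k l m T => [|k IH] l m T I tT r rl.
  exists r, m; eexists _, _, l; split.
  - apply: exec_while_stop; rewrite (eval_value rl (Is _ _ _ I)); exact: I0.
  - by lia.
  - by [].
  - exact: IQ.
have [e0 H] := IS _ _ _ I.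
have [r1 [m1 [t1 [k1 [l1 [E1 ? rl1 I1]]]]]] := H _ rl.
have [r2 [m2 [t2 [k2 [l2 [E2 T2 rl2 Q2]]]]]] := IH _ _ _ I1 (leqnn _) _ rl1.
exists r2, m2; eexists _, _, l2; split.
- by apply: (exec_while_step _ E1 E2); rewrite (eval_value rl (Is _ _ _ I)).
- by lia.
- by [].
- by [].
Qed.

End ProgramLogic.

(** * Calling a relocated program *)

Fixpoint load (i : nat) (es : seq expr) : cmd :=
  if es is e :: es' then Seq (Assign (own + i) e) (load i.+1 es') else Skip.

(** Operations of an oracle start with all registers zero except the arguments, so whatever an
    earlier call left in the [R] shifted registers is erased. *)
Definition call (R : nat) (es : seq expr) (c : cmd) : cmd :=
  Seq (load 0 (es ++ nseq (R - size es) (Const 0))) (reloc c).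

Definition load_cost (es : seq expr) : nat := (sumn [seq (esize e).+1 | e <- es]).+1.

Definition call_cost (R : nat) (es : seq expr) (t : nat) : nat :=
  load_cost (es ++ nseq (R - size es) (Const 0)) + 3 * t.

Fixpoint all_safe (P : nat) (l : seq nat) (m : nat -> nat) (es : seq expr) : Prop :=
  if es is e :: es' then safe P l m e /\ all_safe P l m es' else True.

Lemma all_safe_cat P l m es es' :
  all_safe P l m es -> all_safe P l m es' -> all_safe P l m (es ++ es').
Proof. by elim: es => //= e es IH [se /IH H] /H. Qed.

Lemma exec_load w l m es i r :
  (forall j, j < own -> r j = nth 0 l j) -> all_safe (2 ^ w) l m es ->
  exists r' t k, [/\ exec w (load i es) (r, m) (r', m) t k, t <= load_cost es,
    forall j, j < own + i -> r' j = r j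
    & forall j, j < size es -> r' (own + i + j) = value l m (nth (Const 0) es j)].
Proof.
elim: es i r => [|e es IH] i r rl.
  by move=> _; exists r, 1, 0; split=> //; exact: exec_skip.
move=> /= [se ses].
pose r1 := set_cell r (own + i) (value l m e).
have rl1 j : j < own -> r1 j = nth 0 l j.
  by move=> jo; rewrite /r1 /set_cell ifN; [exact: rl | lia].
have [r' [t [k [E T Ho Hn]]]] := IH i.+1 r1 rl1 ses.
exists r'; eexists _, _; split.
- apply: exec_seq E.
  by have := exec_assign w (own + i) e (r, m); rewrite /= (eval_value rl se); apply.
- by move: T; rewrite /load_cost /=; lia.
- by move=> j jo; rewrite Ho ?/r1 /set_cell ?ifN //; lia.
- case=> [|j] js.
    by rewrite addn0 Ho ?addnS // /r1 /set_cell eqxx.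
  by rewrite addnS -addSn -addnS Hn.
Qed.

Lemma exec_call w R M c es args vm vr vm' t k base l m r :
  exec w c (cells args, vm) (vr, vm') t k -> creg c <= R -> k <= M ->
  base + M <= 2 ^ w -> nth 0 l base_reg = base ->
  (forall a, a < M -> m (base + a) = vm a) ->
  (forall i, i < own -> r i = nth 0 l i) ->
  all_safe (2 ^ w) l m es -> [seq value l m e | e <- es] = args ->
  exists r' m' t' k', [/\ exec w (call R es c) (r, m) (r', m') t' k',
    t' <= call_cost R es t,
    (forall i, i < own -> r' i = nth 0 l i) /\
    (forall i, i < R -> r' (own + i) = vr i),
    forall a, a < M -> m' (base + a) = vm' a
    & forall b, ~~ (base <= b < base + M) -> m' b = m b].
Proof.
move=> E cR kM bM lb mv rl ses ea.
have ses' : all_safe (2 ^ w) l m (es ++ nseq (R - size es) (Const 0)).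
  apply: all_safe_cat => //; elim: (R - _) => //= n IH; split=> //.
  by rewrite expn_gt0.
have [r1 [t1 [k1 [E1 T1 Ho1 Hn1]]]] := exec_load 0 rl ses'.
have ms : mirrors R M base (cells args, vm) (r1, m).
  split=> //=.
  - by rewrite Ho1 // rl.
  - move=> i iR; have := Hn1 i; rewrite addn0 => ->; last first.
      by rewrite size_cat size_nseq; lia.
    rewrite nth_cat nth_nseq /cells -ea; case: ltnP => ies.
      by rewrite (nth_map (Const 0)).
    by rewrite nth_default ?size_map //; case: ifP.
have [[r2 m2] [t2 [k2 [E2 T2 [_ Hr2 Hm2] Ho2 Hb2]]]] :=
  exec_reloc bM E cR kM ms.
exists r2, m2; eexists _, _; split.
- exact: (exec_seq E1 E2).
- by rewrite /call_cost; lia.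
- by split=> // i iO; have /= -> := Ho2 _ iO; rewrite Ho1 ?addn0 // rl.
- exact: Hm2.
- exact: Hb2.
Qed.

Lemma runs_call w R M c es args vm vr vm' t t0 k base l m T Q :
  exec w c (cells args, vm) (vr, vm') t k -> creg c <= R -> k <= M -> t <= t0 ->
  base + M <= 2 ^ w -> nth 0 l base_reg = base ->
  (forall a, a < M -> m (base + a) = vm a) ->
  all_safe (2 ^ w) l m es -> [seq value l m e | e <- es] = args ->
  call_cost R es t0 <= T ->
  (forall m', (forall a, a < M -> m' (base + a) = vm' a) ->
     (forall b, ~~ (base <= b < base + M) -> m' b = m b) -> Q l m') ->
  runs w (call R es c) l m T Q.
Proof.
move=> E cR kM tt0 bM lb mv ses ea tT HQ r rl.
have [r' [m' [t' [k' [E' T' [Ho _] Hm Hb]]]]] :=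
  exec_call E cR kM bM lb mv rl ses ea.
exists r', m', t', k', l; split=> //.
- by move: T' tT; rewrite /call_cost; lia.
- exact: HQ.
Qed.

(** * Graphs over time *)

Lemma has_onthP (T : Type) (a : pred T) (s : seq T) :
  reflect (exists i x, onth s i = Some x /\ a x) (has a s).
Proof.
apply: (iffP idP); elim: s => [|y s IH] //=.
- case: (boolP (a y)) => [ay _|_ /IH [i [x H]]]; first by exists 0, y.
  by exists i.+1, x.
- by case=> i [x []]; rewrite onth0n.
- case=> -[|i] [x [/= E ax]]; first by case: E ax => -> ->.
  by rewrite IH ?orbT //; exists i, x.
Qed.

Section Dynamics.

Variables (directed : bool) (N : nat).
Implicit Types (G : wgraph N) (e f : 'I_N * 'I_N) (us : seq (update N)).

Definition ends (a : update N) : 'I_N * 'I_N :=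
  match a with Insert x y _ | Delete x y => (x, y) end.

Definition new_weight (a : update N) : option int :=
  match a with Insert _ _ z => Some z | Delete _ _ => None end.

Definition joins f e : bool := (e == f) || ~~ directed && (e == (f.2, f.1)).

Lemma joins_refl e : joins e e. Proof. by rewrite /joins eqxx. Qed.

Lemma joins_sym e f : joins e f -> joins f e.
Proof.
move=> /orP[/eqP ->|/andP[dN /eqP ->]]; first exact: joins_refl.
by rewrite /joins dN -surjective_pairing eqxx orbT.
Qed.

Lemma joins_trans e f g : joins e f -> joins f g -> joins e g.
Proof.
move=> /orP[/eqP -> //|/andP[dN /eqP ->]] /orP[/eqP ->|/andP[_ /eqP ->]].
  by rewrite /joins dN eqxx orbT.
by rewrite /= -surjective_pairing joins_refl.
Qed.

Lemma set_edgeE G e f o :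
  set_edge directed G f.1 f.2 o e = if joins f e then o else G e.
Proof. by rewrite ffunE /joins -surjective_pairing. Qed.

Lemma apply_updateE G a e :
  apply_update directed G a e = if joins (ends a) e then new_weight a else G e.
Proof. by case: a => [x y z|x y]; rewrite /= (set_edgeE _ _ (x, y)). Qed.

Definition symmetric_graph G : Prop := ~~ directed -> forall u v, G (u, v) = G (v, u).

(** Update [i] leads from time [i] to time [i.+1]. Hence the updates strictly inside the times
    [lo, ..., lo + h - 1] end at [lo + h - 2], which explains the bound [(lo + h).-1] below. *)
Definition at_time G us t : wgraph N :=
  foldl (apply_update directed (N:=N)) G (take t us).

Definition touch us i e : bool := if onth us i is Some a then joins (ends a) e else false.

Definition touched us lo hi e : bool := has (fun j => touch us j e) (index_iota lo hi).

Lemma touchedP us lo hi e :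
  reflect (exists2 j, lo <= j < hi & touch us j e) (touched us lo hi e).
Proof.
apply: (iffP hasP) => -[j jr tj]; exists j => //; by move: jr; rewrite mem_index_iota.
Qed.

Lemma touched_recr us lo hi e :
  touched us lo hi.+1 e = touched us lo hi e || (lo <= hi) && touch us hi e.
Proof.
apply/touchedP/orP.
  move=> [j jr tj]; case: (eqVneq j hi) => [<-|ne]; first by right; rewrite tj andbT; lia.
  by left; apply/touchedP; exists j => //; lia.
case=> [/touchedP[j jr tj]|/andP[lh th]]; first by exists j => //; lia.
by exists hi => //; lia.
Qed.

Lemma touched_geq us lo hi e : hi <= lo -> touched us lo hi e = false.
Proof. by move=> hl; apply/touchedP => -[j]; lia. Qed.

Lemma touched_sub us lo hi lo' hi' e :
  lo <= lo' -> hi' <= hi -> touched us lo' hi' e -> touched us lo hi e.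
Proof. by move=> ll hh /touchedP[j jr tj]; apply/touchedP; exists j => //; lia. Qed.

Lemma touch_oversize us i e : size us <= i -> touch us i e = false.
Proof. by move=> si; rewrite /touch onth_default. Qed.

(** Intervals may reach past the last update, because the number of times is rounded up to a power
    of two; nothing changes there. *)
Lemma touched_minn us lo hi e : touched us lo (minn hi (size us)) e = touched us lo hi e.
Proof.
apply/touchedP/touchedP => -[j jr tj]; exists j => //; first lia.
case: (ltnP j (size us)) => [|/touch_oversize] => [|H]; first lia.
by rewrite H in tj.
Qed.

Lemma touch_joins us i e f : joins e f -> touch us i e -> touch us i f.
Proof. rewrite /touch; case: onth => // a H /joins_trans; exact. Qed.

Lemma touched_joins us lo hi e f : joins e f -> touched us lo hi e = touched us lo hi f.
Proof.
move=> ef; apply/touchedP/touchedP => -[j jr tj]; exists j => //.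
  exact: touch_joins tj.
by apply: touch_joins tj; apply: joins_sym.
Qed.

Lemma joins_swap u v : ~~ directed -> joins (u, v) (v, u).
Proof. by move=> dN; rewrite /joins dN eqxx orbT. Qed.

Lemma at_timeS G us t e :
  at_time G us t.+1 e =
  if onth us t is Some a then
    if joins (ends a) e then new_weight a else at_time G us t e
  else at_time G us t e.
Proof.
rewrite /at_time; case E: onth => [a|].
  have ts : t < size us by rewrite -onthTE E.
  by rewrite (take_nth a ts) foldl_rcons (@onth_nth _ a _ _ _ E) apply_updateE.
have st : size us <= t by rewrite -onthNE E.
by rewrite !take_oversize //; lia.
Qed.

Lemma at_time_untouched G us lo hi e :
  lo <= hi -> touched us lo hi e = false -> at_time G us hi e = at_time G us lo e.
Proof.
elim: hi => [|hi IH]; first by rewrite leqn0 => /eqP ->.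
rewrite leq_eqVlt => /orP[/eqP -> //|]; rewrite ltnS => lh.
rewrite touched_recr lh /=.
case E: (touched us lo hi e) => //= th; rewrite at_timeS.
by move: th; rewrite /touch; case: onth => [a ->|_]; rewrite IH.
Qed.

(* The graph of edges present throughout the times [lo, ..., lo + h - 1] and
   not updated in between. *)
Definition block G us lo h : wgraph N :=
  [ffun e => if touched us lo (lo + h).-1 e then None else at_time G us lo e].

Lemma block_single G us t : block G us t 1 = at_time G us t.
Proof. by apply/ffunP => e; rewrite ffunE touched_geq //; lia. Qed.

Lemma blockS_sub G us p lo h e z :
  p <= lo -> lo + h <= p + h.*2 -> 0 < h ->
  block G us p h.*2 e = Some z -> block G us lo h e = Some z.
Proof.
move=> pl lh h0; rewrite !ffunE; case: ifP => // tp <-.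
rewrite ifF; first apply: at_time_untouched => //; apply: contraFF tp.
  by apply: touched_sub; lia.
by apply: touched_sub; lia.
Qed.

(** This is why passing from an interval to a half only has to examine the edges updated inside the
    larger interval. *)
Lemma block_child G us p lo h e :
  p <= lo -> lo + h <= p + h.*2 -> 0 < h -> touched us p (p + h.*2).-1 e = false ->
  block G us lo h e = block G us p h.*2 e.
Proof.
move=> pl lh h0 tp; rewrite !ffunE tp ifF.
  by apply: at_time_untouched => //; apply: contraFF tp; apply: touched_sub; lia.
by apply: contraFF tp; apply: touched_sub; lia.
Qed.

Lemma at_time_sym G us t : symmetric_graph G -> symmetric_graph (at_time G us t).
Proof.
move=> sG dN u v; elim: t => [|t IH]; first by rewrite /at_time take0 /= sG.
rewrite !at_timeS IH; case: onth => // a.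
suff -> : joins (ends a) (u, v) = joins (ends a) (v, u) by [].
by apply/idP/idP => /joins_trans; apply; apply: joins_swap.
Qed.

Lemma block_sym G us lo h : symmetric_graph G -> symmetric_graph (block G us lo h).
Proof.
move=> sG dN u v; rewrite !ffunE (at_time_sym us lo sG) //.
by rewrite (touched_joins _ _ _ (joins_swap u v dN)).
Qed.

Definition cleared G us : wgraph N :=
  foldl (fun G a => set_edge directed G (ends a).1 (ends a).2 None) G us.

Lemma clearedE G us e :
  cleared G us e = if has (fun a => joins (ends a) e) us then None else G e.
Proof.
rewrite /cleared; elim/last_ind: us => [//|us a IH].
by rewrite foldl_rcons set_edgeE IH has_rcons; case: joins.
Qed.

(** The root of the recursion: an interval longer than the whole history contains every update. *)
Lemma block_all G us h : size us < h -> block G us 0 h = cleared G us.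
Proof.
move=> sh; apply/ffunP => e; rewrite ffunE clearedE /at_time take0 /=.
suff -> : touched us 0 (0 + h).-1 e = has (fun a => joins (ends a) e) us by [].
apply/touchedP/has_onthP => [[j _]|[j [a [E ja]]]].
  by rewrite /touch; case E: onth => [a|//] ja; exists j, a.
exists j; last by rewrite /touch E.
have : j < size us by rewrite -onthTE E.
lia.
Qed.

(* The graph reached on the way from a block to its half [lo, ..., lo + h - 1]
   after handling the edges updated at the times [p, ..., i - 1]. *)
Definition transit G us p lo h i : wgraph N :=
  [ffun e => if touched us p i e then block G us lo h e else block G us p h.*2 e].

Lemma transitE G us p lo h i e :
  transit G us p lo h i e =
  if touched us p i e then block G us lo h e else block G us p h.*2 e.
Proof. exact: ffunE. Qed.

Lemma transit_start G us p lo h : transit G us p lo h p = block G us p h.*2.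
Proof. by apply/ffunP => e; rewrite ffunE touched_geq. Qed.

Lemma transit_end G us p lo h i :
  p <= lo -> lo + h <= p + h.*2 -> 0 < h -> minn (p + h.*2).-1 (size us) <= i ->
  transit G us p lo h i = block G us lo h.
Proof.
move=> pl lh h0 si; apply/ffunP => e; rewrite ffunE; case: ifP => // ti.
rewrite (block_child G pl lh h0) // -touched_minn.
by apply: contraFF ti; apply: touched_sub.
Qed.

(** Together with [admissible_sub] this makes every intermediate graph admissible. *)
Lemma transit_sub G us p lo h i e z :
  p <= lo -> lo + h <= p + h.*2 -> 0 < h ->
  transit G us p lo h i e = Some z -> at_time G us lo e = Some z.
Proof.
move=> pl lh h0.
have H : block G us lo h e = Some z -> at_time G us lo e = Some z.
  by rewrite ffunE; case: ifP.
by rewrite ffunE; case: ifP => // _ /(blockS_sub pl lh h0).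
Qed.

Lemma transit_sym G us p lo h i :
  symmetric_graph G -> symmetric_graph (transit G us p lo h i).
Proof.
move=> sG dN u v; rewrite !transitE.
rewrite (block_sym us lo h sG dN u v) (block_sym us p h.*2 sG dN u v).
by rewrite (touched_joins _ _ _ (joins_swap u v dN)).
Qed.

Lemma touch_ends us i a e : onth us i = Some a -> touch us i e = joins (ends a) e.
Proof. by rewrite /touch => ->. Qed.

(** An edge updated inside the larger interval is not stable there, and at its first update it has
    not been inserted yet; so its insertion is legal. *)
Lemma transit_none G us p lo h i a :
  p <= i -> i.+1 < p + h.*2 -> onth us i = Some a -> touched us p i (ends a) = false ->
  transit G us p lo h i (ends a) = None.
Proof.
move=> pi ih E t0; rewrite ffunE t0 ffunE ifT //.
by apply/touchedP; exists i; [lia | rewrite (touch_ends _ E) joins_refl].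
Qed.

Lemma transit_insert G us p lo h i a z :
  symmetric_graph G -> p <= i -> onth us i = Some a ->
  touched us p i (ends a) = false -> block G us lo h (ends a) = Some z ->
  transit G us p lo h i.+1 =
  apply_update directed (transit G us p lo h i) (Insert (ends a).1 (ends a).2 z).
Proof.
move=> sG pi E t0 bz; apply/ffunP => e.
rewrite apply_updateE /= -surjective_pairing.
rewrite [LHS]ffunE touched_recr pi (touch_ends _ E) /=.
case je: (joins (ends a) e); last by rewrite orbF [RHS]ffunE.
rewrite orbT -bz; case/orP: (je) => [/eqP -> //|/andP[dN /eqP ->]].
by rewrite -(block_sym us lo h sG dN) -surjective_pairing.
Qed.

(** The two reasons for inserting nothing at update [i]: the edge was dealt with at an earlier
    update, or it is not stable on the half. *)
Lemma transit_skip G us p lo h i a :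
  symmetric_graph G -> p <= i -> i.+1 < p + h.*2 -> onth us i = Some a ->
  touched us p i (ends a) \/ block G us lo h (ends a) = None ->
  transit G us p lo h i.+1 = transit G us p lo h i.
Proof.
move=> sG pi ih E H; apply/ffunP => e; rewrite !transitE.
rewrite touched_recr pi (touch_ends _ E) /=.
case je: (joins (ends a) e); last by rewrite orbF.
rewrite orbT -(touched_joins us p i je); case: ifP => // t0.
have -> : block G us p h.*2 e = None.
  by rewrite ffunE ifT //; apply/touchedP; exists i; [lia | rewrite (touch_ends _ E)].
case: H => [|bn]; first by rewrite t0.
rewrite -bn; case/orP: (je) => [/eqP -> //|/andP[dN /eqP ->]].
by rewrite -(block_sym us lo h sG dN) -surjective_pairing.
Qed.

Lemma walk_length_sub G G' u p :
  (forall e z, G' e = Some z -> G e = Some z) -> path (edge G') u p ->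
  path (edge G) u p /\ walk_length G' u p = walk_length G u p.
Proof.
move=> sub; elim: p u => //= v p IH u /andP[].
rewrite /edge; case E: (G' (u, v)) => [z|//] _ /IH[-> ->].
by rewrite (sub _ _ E).
Qed.

(** A closed walk of the subgraph is a closed walk of the same length in the whole graph; the other
    conditions concern single edges, apart from symmetry, which is assumed. *)
Lemma admissible_sub W w G G' :
  (forall e z, G' e = Some z -> G e = Some z) -> symmetric_graph G' ->
  admissible directed W w G -> admissible directed W w G'.
Proof.
move=> sub sG' [loop _ wt cyc]; split=> //.
- by move=> u; case E: (G' (u, u)) => [z|//]; rewrite -(loop u) (sub _ _ E).
- by move=> u v z /sub /wt.
- by move=> u p /(walk_length_sub sub)[pG ->]; apply: cyc.
Qed.

Lemma at_time_admissible W w G us t :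
  admissible directed W w G -> legal_seq directed W w G us ->
  admissible directed W w (at_time G us t).
Proof.
rewrite /at_time; elim: us G t => [|a us IH] G [|t] //= aG [[_ aG'] leg].
exact: IH.
Qed.

Lemma admissible_symmetric W w G : admissible directed W w G -> symmetric_graph G.
Proof. by case. Qed.

End Dynamics.

(** * Encodings in memory *)

Section Encoding.

Variables (directed : bool) (w N : nat).
Implicit Types (G : wgraph N) (e : 'I_N * 'I_N) (us : seq (update N)).

(* The graph seen by a scan of the updates for the half [lo, ..., lo + h - 1],
   after the first [j] updates. *)
Definition scan_state G us lo h j e : option int :=
  if touched directed us lo (minn (lo + h).-1 j) e then None
  else at_time directed G us (minn j lo) e.

Lemma scan_state0 G us lo h e : scan_state G us lo h 0 e = G e.
Proof. by rewrite /scan_state minn0 touched_geq // min0n /at_time take0. Qed.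

Lemma scan_state_end G us lo h e :
  scan_state G us lo h (size us) e = block directed G us lo h e.
Proof.
rewrite /scan_state touched_minn ffunE; case: ifP => // _.
have [sl|sl] := boolP (lo < size us); first by have -> : minn (size us) lo = lo by lia.
by rewrite /at_time !take_oversize //; lia.
Qed.

(** An update of the edge before [lo] fixes its state at time [lo], one inside the half makes it
    unstable, and a later one is irrelevant. *)
Lemma scan_stateS G us lo h j e b :
  onth us j = Some b ->
  scan_state G us lo h j.+1 e =
  if joins directed (ends b) e then
    if j < lo then new_weight b
    else if j.+1 < lo + h then None else scan_state G us lo h j e
  else scan_state G us lo h j e.
Proof.
move=> E; rewrite /scan_state; case: (boolP (j < lo)) => jl.
  rewrite !touched_geq; try lia.
  have -> : minn j.+1 lo = j.+1 by lia.
  have -> : minn j lo = j by lia.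
  by rewrite at_timeS E.
have -> : minn j.+1 lo = lo by lia.
have -> : minn j lo = lo by lia.
case: (boolP (j.+1 < lo + h)) => jh.
  have -> : minn (lo + h).-1 j.+1 = j.+1 by lia.
  have -> : minn (lo + h).-1 j = j by lia.
  rewrite touched_recr leqNgt jl (touch_ends _ _ E) /=.
  by case: joins; rewrite ?orbT ?orbF.
have -> : minn (lo + h).-1 j.+1 = (lo + h).-1 by lia.
have -> : minn (lo + h).-1 j = (lo + h).-1 by lia.
by case: joins.
Qed.

Lemma seenS us p i j e b : onth us j = Some b ->
  touched directed us p (minn i j.+1) e =
  touched directed us p (minn i j) e || (p <= j < i) && joins directed (ends b) e.
Proof.
move=> E; case: (boolP (j < i)) => ji.
  have -> : minn i j.+1 = j.+1 by lia.
  have -> : minn i j = j by lia.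
  by rewrite touched_recr (touch_ends _ _ E) andbT.
have -> : minn i j.+1 = i by lia.
have -> : minn i j = i by lia.
by rewrite andbF orbF.
Qed.

Lemma nth_flatten_const (T : Type) (x0 : T) k (ss : seq (seq T)) i j :
  all (fun s => size s == k) ss -> j < k ->
  nth x0 (flatten ss) (i * k + j) = nth x0 (nth [::] ss i) j.
Proof.
elim: ss i => [|s ss IH] i; first by rewrite /= !nth_nil.
move=> /= /andP[/eqP sk ssk] jk; rewrite nth_cat sk.
case: i => [|i] /=; first by rewrite mul0n jk.
rewrite ifN; last by rewrite mulSn -leqNgt -addnA leq_addr.
by rewrite mulSn -addnA addKn IH.
Qed.

Lemma size_flatten_const (T : Type) k (ss : seq (seq T)) :
  all (fun s => size s == k) ss -> size (flatten ss) = k * size ss.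
Proof.
elim: ss => [|s ss IH] /=; first by rewrite muln0.
by move=> /andP[/eqP sk /IH]; rewrite size_cat sk mulnS => ->.
Qed.

Definition option_words (o : option int) : seq nat :=
  if o is Some z then [:: 1; word_of_int w z] else [:: 0; 0].

Lemma graph_words_sizes G :
  all (fun s => size s == 2)
    [seq option_words (G (u, v)) | u <- enum 'I_N, v <- enum 'I_N].
Proof. by apply/allP => s /allpairsP[[u v] [_ _ ->]]; rewrite /option_words; case: (G _). Qed.

Lemma size_graph_words G : size (graph_words w G) = 2 * N * N.
Proof.
rewrite (size_flatten_const (graph_words_sizes G)).
by rewrite size_allpairs size_enum_ord mulnA.
Qed.

Lemma nth_graph_words G (u v : 'I_N) f :
  f < 2 ->
  nth 0 (graph_words w G) (2 * (u * N + v) + f) = nth 0 (option_words (G (u, v))) f.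
Proof.
move=> f2; rewrite mulnC (nth_flatten_const _ _ (graph_words_sizes G)) //.
congr nth; rewrite nth_flatten_const //; last first.
  by apply/allP => s /mapP[u' _ ->]; rewrite size_map size_enum_ord.
rewrite (nth_map u) ?size_enum_ord // (nth_map v) ?size_enum_ord //.
by rewrite !nth_ord_enum.
Qed.

Lemma cell_lt (u v : 'I_N) : (u * N + v).+1 <= N * N.
Proof. by have := ltn_ord u; have := ltn_ord v; nia. Qed.

Lemma cell_inj (u v x y : 'I_N) : (u * N + v == x * N + y) = ((u, v) == (x, y)).
Proof.
apply/eqP/eqP => [H|[-> ->] //].
have N0 : 0 < N by have := ltn_ord u; lia.
have := congr1 (divn^~ N) H; have := congr1 (modn^~ N) H.
rewrite /= !modnMDl !modn_small // !divnMDl // !divn_small // !addn0.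
by move=> /val_inj -> /val_inj ->.
Qed.

Lemma cellP b : b < N * N -> exists u v : 'I_N, b = u * N + v.
Proof.
move=> bN; have N0 : 0 < N by case: N bN.
have ub : b %/ N < N by rewrite ltn_divLR.
have vb : b %% N < N by rewrite ltn_mod.
by exists (Ordinal ub), (Ordinal vb); rewrite /= -divn_eq.
Qed.

(** Each matrix entry occupies two words, so [a./2] is the index of the entry to which word [a]
    belongs. *)
Lemma graph_words_clear G (x y : 'I_N) a :
  cells (graph_words w (set_edge directed G x y None)) a =
  if (a./2 == x * N + y) || ~~ directed && (a./2 == y * N + x) then 0
  else cells (graph_words w G) a.
Proof.
rewrite /cells; case: (ltnP a (2 * N * N)) => [aN|Na]; last first.
  rewrite !nth_default ?size_graph_words //; by case: ifP.
have a2 : a = 2 * a./2 + odd a by lia.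
have hb : a./2 < N * N by lia.
have [u [v uv]] := cellP hb.
rewrite {1 4}a2 uv !nth_graph_words; try by case: (odd a).
by rewrite !cell_inj ffunE; case: ifP => // _; case: odd.
Qed.

Lemma update_words_sizes us :
  all (fun s => size s == 4) [seq update_words w a | a <- us].
Proof. by apply/allP => s; elim: us => //= a us IH; rewrite inE => /orP[/eqP ->|//]; case: a. Qed.

Lemma size_updates us : size (flatten [seq update_words w a | a <- us]) = 4 * size us.
Proof. by rewrite (size_flatten_const (update_words_sizes us)) size_map. Qed.

Lemma nth_updates us i a f :
  onth us i = Some a -> f < 4 ->
  nth 0 (flatten [seq update_words w a | a <- us]) (4 * i + f) =
  nth 0 (update_words w a) f.
Proof.
move=> E f4; rewrite mulnC nth_flatten_const ?update_words_sizes //.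
rewrite (nth_map a) -?onthTE ?E //.
by rewrite (@onth_nth _ a _ _ _ E).
Qed.

(* The flag and the weight of a possibly absent edge, as in [graph_words], but
   with an arbitrary weight if the edge is absent. *)
Definition encodes (o : option int) (f wt : nat) : Prop :=
  match o with
  | Some z => f = 1 /\ wt = word_of_int w z
  | None => f = 0
  end.

Lemma encodes_option_words o :
  encodes o (nth 0 (option_words o) 0) (nth 0 (option_words o) 1).
Proof. by case: o. Qed.

(** Updates are encoded so that their first and last words can be taken over directly as flag and
    weight of the edge after the update. *)
Lemma encodes_update (a : update N) :
  encodes (new_weight a) (nth 0 (update_words w a) 0) (nth 0 (update_words w a) 3).
Proof. by case: a. Qed.

Lemma update_words_ends (a : update N) :
  nth 0 (update_words w a) 1 = (ends a).1 /\ nth 0 (update_words w a) 2 = (ends a).2.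
Proof. by case: a. Qed.

End Encoding.

(** * The offline preprocessing *)

Notation rn := 0 (only parsing).
Notation rN := 1 (only parsing).
Notation rT := 2 (only parsing).
Notation rS := 3 (only parsing).
Notation rX := 5 (only parsing).
Notation rK := 6 (only parsing).
Notation roff := 7 (only parsing).
Notation rh := 8 (only parsing).
Notation rlo := 9 (only parsing).
Notation rp := 10 (only parsing).
Notation ri := 11 (only parsing).
Notation rx := 12 (only parsing).
Notation ry := 13 (only parsing).
Notation rf := 14 (only parsing).
Notation rwt := 15 (only parsing).
Notation rsn := 16 (only parsing).
Notation rj := 17 (only parsing).
Notation rad := 18 (only parsing).
Notation rsrc := 19 (only parsing).
Notation rdst := 20 (only parsing).
Notation rlen := 21 (only parsing).
Notation rcnt := 22 (only parsing).

Declare Scope ram_scope.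
Delimit Scope ram_scope with ram.
Notation "a +! b" := (Bin OpAdd a b) (at level 50, left associativity) : ram_scope.
Notation "a *! b" := (Bin OpMul a b) (at level 40, left associativity) : ram_scope.
Notation "a <! b" := (Bin OpLt a b) (at level 70) : ram_scope.
Notation "a =! b" := (Bin OpEq a b) (at level 70) : ram_scope.
Notation "x <-- e" := (Assign x e) (at level 75) : ram_scope.
Notation "c ;; d" := (Seq c d) (at level 80, right associativity) : ram_scope.
Local Open Scope ram_scope.

Definition copy : cmd :=
  rcnt <-- Const 0 ;;
  While (Reg rcnt <! Reg rlen)
    (Poke (Reg rdst +! Reg rcnt) (Peek (Reg rsrc +! Reg rcnt)) ;;
     rcnt <-- Reg rcnt +! Const 1).

Definition clear (directed : bool) : cmd :=
  ri <-- Const 0 ;;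
  While (Reg ri <! Reg rT)
    (rad <-- Reg roff +! Const 4 *! Reg ri ;;
     rx <-- Peek (Reg rad +! Const 1) ;;
     ry <-- Peek (Reg rad +! Const 2) ;;
     rad <-- Reg rX +! Const 2 *! (Reg rx *! Reg rN +! Reg ry) ;;
     Poke (Reg rad) (Const 0) ;;
     Poke (Reg rad +! Const 1) (Const 0) ;;
     (if directed then Skip else
        rad <-- Reg rX +! Const 2 *! (Reg ry *! Reg rN +! Reg rx) ;;
        Poke (Reg rad) (Const 0) ;;
        Poke (Reg rad +! Const 1) (Const 0)) ;;
     ri <-- Reg ri +! Const 1).

(** Product and sum stand for conjunction and disjunction, since [value] covers arithmetic and
    comparisons but no bitwise operations. *)
Definition touch_test (directed : bool) : expr :=
  let same := (Reg rx =! Peek (Reg rad +! Const 1)) *!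
              (Reg ry =! Peek (Reg rad +! Const 2)) in
  if directed then same else
  same +! (Reg rx =! Peek (Reg rad +! Const 2)) *!
          (Reg ry =! Peek (Reg rad +! Const 1)).

(* Afterwards [rf] and [rwt] encode the edge from [rx] to [ry] as it is throughout
   the half [rlo, ..., rlo + rh - 1], and [rsn] tells whether one of the updates
   [rp, ..., ri - 1] has already dealt with it. *)
Definition scan (directed : bool) : cmd :=
  While (Reg rj <! Reg rT)
    (rad <-- Reg roff +! Const 4 *! Reg rj ;;
     If (touch_test directed)
       (If (Reg rj <! Reg rlo)
          (rf <-- Peek (Reg rad) ;; rwt <-- Peek (Reg rad +! Const 3))
          (If (Reg rj +! Const 1 <! Reg rlo +! Reg rh) (rf <-- Const 0) Skip) ;;
        If ((Reg rp <! Reg rj +! Const 1) *! (Reg rj <! Reg ri))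
          (rsn <-- Const 1) Skip)
       Skip ;;
     rj <-- Reg rj +! Const 1).

Definition scan_cost (T : nat) : nat := 120 * T + 20.

Section Fragments.

Variables (directed : bool) (w n N S X K : nat) (G : wgraph N) (us : seq (update N)).
Let T := size us.
Let off := 2 * N * N.

Definition regs base h lo p i x y f wt sn j ad src dst len cnt : seq nat :=
  [:: n; N; T; S; base; X; K; off; h; lo; p; i; x; y; f; wt; sn; j; ad;
      src; dst; len; cnt].

(** Equal source and target are allowed because the first half of an interval shares the slot of
    that interval. *)
Lemma runs_copy base h lo p i x y f wt sn j ad src dst len cnt m t Q :
  src = dst \/ src + len <= dst \/ dst + len <= src ->
  src + len < 2 ^ w -> dst + len < 2 ^ w -> 1 < 2 ^ w -> 16 * len + 20 <= t ->
  (forall m', (forall a, a < len -> m' (dst + a) = m (src + a)) ->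
     (forall b, ~~ (dst <= b < dst + len) -> m' b = m b) ->
     Q (regs base h lo p i x y f wt sn j ad src dst len len) m') ->
  runs w copy (regs base h lo p i x y f wt sn j ad src dst len cnt) m t Q.
Proof.
move=> dis sP dP P1 ht HQ.
apply: runs_assign_seq => //=; [lia..|].
pose Inv k l m' := [/\ k <= len,
  l = regs base h lo p i x y f wt sn j ad src dst len (len - k),
  forall a, a < len - k -> m' (dst + a) = m (src + a)
  & forall b, ~~ (dst <= b < dst + (len - k)) -> m' b = m b].
apply: (runs_while (Inv := Inv) (c0 := 12) (k := len)).
- by move=> k l m' [kl -> _ _] /=; lia.
- by move=> l m' [_ -> _ _] /=; rewrite subn0 ltnn.
- move=> k l m' [kl -> Hin Hout] /=.
  have clt : len - k.+1 < len by lia.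
  split; first by rewrite clt.
  apply: runs_poke_seq => //=; [lia..|].
  apply: runs_assign => //=; [lia..|].
  split; [lia| |move=> a al|move=> b bl].
  + by have -> : len - k.+1 + 1 = len - k by lia.
  + rewrite /set_cell; case: eqP => [E|ne].
      have -> : a = len - k.+1 by lia.
      (* The source cell still has its original content: it lies outside the target, or it is the
         target cell about to be written. *)
      by apply: Hout; lia.
    by apply: Hin; lia.
  + by rewrite /set_cell ifN; [apply: Hout; lia|lia].
- by split=> //; [rewrite subnn | move=> a; lia].
- by rewrite /=; lia.
- move=> l m' [_ -> Hin Hout]; rewrite subn0 in Hin Hout *.
  exact: HQ.
Qed.

(** Slots start right after the input. The two extra cells keep addresses [0] and [1], which finally
    hold the current slot address and the slot size, below the slots even for an empty input. *)
Hypothesis XE : X = 2 * N * N + 4 * size us + 2.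

Definition holds_input (m : nat -> nat) : Prop :=
  forall b, b < X ->
    m b = cells (graph_words w G ++ flatten [seq update_words w a | a <- us]) b.

Lemma input_update m i a f :
  holds_input m -> onth us i = Some a -> f < 4 ->
  m (off + 4 * i + f) = nth 0 (update_words w a) f.
Proof.
move=> Hm E f4; have iT : i < size us by rewrite -onthTE E.
rewrite Hm; last by rewrite XE /off; lia.
rewrite /cells nth_cat size_graph_words ifN; last by rewrite /off; lia.
rewrite -(nth_updates w E f4); congr nth; rewrite /off; lia.
Qed.

Lemma input_graph m (u v : 'I_N) f :
  holds_input m -> f < 2 ->
  m (2 * (u * N + v) + f) = nth 0 (option_words w (G (u, v))) f.
Proof.
move=> Hm f2; have uv := cell_lt u v.
have lt : 2 * (u * N + v) + f < 2 * N * N by lia.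
rewrite Hm; last by rewrite XE; lia.
by rewrite /cells nth_cat size_graph_words lt nth_graph_words.
Qed.

Lemma onth_lt (i : nat) : i < size us -> exists a, onth us i = Some a.
Proof. by rewrite -onthTE; case: onth => // a _; exists a. Qed.

Hypothesis X_word : 2 * X < 2 ^ w.

Lemma touch_testP base h lo p i f wt sn j src dst len cnt m (u v : 'I_N) b :
  holds_input m -> onth us j = Some b ->
  let l := regs base h lo p i u v f wt sn j (off + 4 * j) src dst len cnt in
  safe (2 ^ w) l m (touch_test directed) /\
  (value l m (touch_test directed) != 0) = joins directed (ends b) (u, v).
Proof.
move=> Hm E /=; have [e1 e2] := update_words_ends w b.
have jT : j < size us by rewrite -onthTE E.
have r1 : m (off + 4 * j + 1) = (ends b).1 by rewrite (input_update Hm E).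
have r2 : m (off + 4 * j + 2) = (ends b).2 by rewrite (input_update Hm E).
have lt k : k < 4 -> off + 4 * j + k < 2 ^ w by rewrite /off; lia.
have mul (a c : bool) : a * c < 2 ^ w by case: a; case: c; lia.
have P1 : 1 < 2 ^ w by lia.
have l1 := lt 1 isT; have l2 := lt 2 isT.
have add (a c a' c' : bool) : a * c + a' * c' < 2 ^ w.
  by case: a; case: c; case: a'; case: c'; lia.
have P2 : 2 < 2 ^ w by lia.
rewrite /touch_test /joins; case: (ends b) r1 r2 => x y /= r1 r2.
case: directed => /=; rewrite r1 r2 ?addn_eq0 !muln_eq0 !eqb0.
  split; first by do ![split].
  by rewrite orbF -negb_and negbK xpair_eqE -!val_eqE.
split; first by do ![split].
rewrite !xpair_eqE -!val_eqE /=.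
by do 4! case: (_ == _).
Qed.

Lemma runs_scan base h lo p i (u v : 'I_N) f wt ad src dst len cnt m t Q :
  holds_input m -> encodes w (G (u, v)) f wt ->
  lo + h < 2 ^ w -> scan_cost T <= t ->
  (forall f wt ad, encodes w (block directed G us lo h (u, v)) f wt ->
     Q (regs base h lo p i u v f wt (touched directed us p (minn i T) (u, v)) T ad
          src dst len cnt) m) ->
  runs w (scan directed)
    (regs base h lo p i u v f wt 0 0 ad src dst len cnt) m t Q.
Proof.
move=> Hm enc0 lhP ht HQ.
have TX : 4 * T < X by rewrite XE /T; lia.
pose Inv k l m' := [/\ k <= T, m' = m & exists f wt ad,
  encodes w (scan_state directed G us lo h (T - k) (u, v)) f wt /\
  l = regs base h lo p i u v f wt (touched directed us p (minn i (T - k)) (u, v))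
        (T - k) ad src dst len cnt].
apply: (runs_while (Inv := Inv) (c0 := 100) (k := T)).
- by move=> k l m' [kT -> [f' [wt' [ad' [_ ->]]]]] /=; lia.
- by move=> l m' [_ -> [f' [wt' [ad' [_ ->]]]]] /=; rewrite subn0 ltnn.
- move=> k l m' [kT -> [f' [wt' [ad' [enc ->]]]]] /=.
  have jT : T - k.+1 < size us by rewrite /T; lia.
  split; first by rewrite jT.
  have [b E] := onth_lt jT.
  have jS : T - k = (T - k.+1).+1 by lia.
  set j := T - k.+1 in enc jT E jS *.
  apply: runs_assign_seq => //=; [rewrite /off; lia|].
  have lt c : c < 4 -> off + 4 * j + c < 2 ^ w by rewrite /off; lia.
  have l3 := lt 3 isT.
  (* All branches of the loop body meet before the increment of [rj]; [fin] restores the invariant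
     from there. *)
  have fin f1 wt1 sn1 :
      encodes w (scan_state directed G us lo h j.+1 (u, v)) f1 wt1 ->
      sn1 = touched directed us p (minn i j.+1) (u, v) :> nat ->
      runs w (rj <-- Reg rj +! Const 1)
        (regs base h lo p i u v f1 wt1 sn1 j (off + 4 * j) src dst len cnt) m 4 (Inv k).
    move=> enc1 sn1E; apply: runs_assign => //=; first lia.
    split=> //; first lia.
    by exists f1, wt1, (off + 4 * j); rewrite jS addn1 sn1E.
  have [ts tv] := touch_testP base h lo p i f' wt'
    (touched directed us p (minn i j) (u, v)) src dst len cnt u v Hm E.
  have tsize : (esize (touch_test directed)).+1 <= 30.
    by rewrite /touch_test; case: directed.
  pose mid l' m' := m' = m /\ exists f1 wt1 sn1,
    [/\ encodes w (scan_state directed G us lo h j.+1 (u, v)) f1 wt1,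
        sn1 = touched directed us p (minn i j.+1) (u, v) :> nat
      & l' = regs base h lo p i u v f1 wt1 sn1 j (off + 4 * j) src dst len cnt].
  apply: (@runs_seq _ 80 mid) => //; last first.
    move=> _ _ [-> [f1 [wt1 [sn1 [? ? ->]]]]].
    by apply: (@runs_le _ _ _ _ 4); [lia|exact: fin].
  apply: runs_if => //; first lia.
  + rewrite tv => jn.
    (* Between the two conditionals flag and weight already account for update [j], but [rsn] does
       not. *)
    pose mid1 l' m' := m' = m /\ exists f1 wt1,
      encodes w (scan_state directed G us lo h j.+1 (u, v)) f1 wt1 /\
      l' = regs base h lo p i u v f1 wt1 (touched directed us p (minn i j) (u, v)) j
             (off + 4 * j) src dst len cnt.
    apply: (@runs_seq _ 25 mid1) => //; [|lia|].
    * have SS := scan_stateS directed G lo h (u, v) E; rewrite jn in SS.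
      apply: runs_if => //=; [lia| |].
      - rewrite eqb0 negbK => jlo; rewrite jlo in SS.
        apply: runs_assign_seq => //=.
        apply: runs_assign => //=.
          lia.
        split=> //; eexists _, _; split; last by [].
        rewrite SS -[off + 4 * j]addn0 !(input_update Hm E) // addn0 (input_update Hm E) //.
        exact: encodes_update.
      - move=> /eqP; rewrite eqb0 => /negbTE jlo; rewrite jlo in SS.
        apply: runs_if => //=; [lia| |].
        + rewrite eqb0 negbK addn1 => jh; rewrite jh in SS.
          apply: runs_assign => //=; first lia.
          by split=> //; exists 0, wt'; rewrite SS.
        + move=> /eqP; rewrite eqb0 addn1 => /negbTE jh; rewrite jh in SS.
          apply: runs_skip => //=.
          by split=> //; exists f', wt'; rewrite SS.
    * move=> _ _ [-> [f1 [wt1 [enc1 ->]]]].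
      have SS := seenS directed p i (u, v) E; rewrite jn andbT in SS.
      have sz : 80 - (esize (touch_test directed)).+1 - 25 >= 25 by lia.
      apply: (runs_le sz).
      apply: runs_if => //=.
        by do !split => //; try lia; case: (_ < _); case: (_ < _); lia.
      - rewrite addn1 ltnS muln_eq0 !eqb0 -negb_and negbK => pji.
        apply: runs_assign => //=; first lia.
        by split=> //; exists f1, wt1, 1; split=> //; rewrite SS pji orbT.
      - move=> /eqP; rewrite addn1 ltnS muln_eq0 !eqb0 -negb_and => /negbTE pji.
        apply: runs_skip => //=.
        by split=> //; exists f1, wt1; eexists; split=> //; rewrite SS pji orbF.
  + move=> /eqP H; move: (H); rewrite -[_ == 0]negbK tv => /negbTE jn.
    apply: runs_skip; first lia.
    split=> //; exists f', wt'; eexists; split; last by [].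
    * by rewrite (scan_stateS directed G lo h (u, v) E) jn.
    * by rewrite (seenS directed p i (u, v) E) jn andbF orbF.
- split=> //; exists f, wt, ad; rewrite subnn scan_state0; split=> //.
- by move: ht; rewrite /scan_cost /=; lia.
- move=> l m' [_ -> [f' [wt' [ad' [enc ->]]]]]; rewrite subn0 in enc *.
  by apply: HQ; rewrite -scan_state_end.
Qed.

End Fragments.

(** * The recursion over time intervals *)

Definition insert_edges (directed : bool) (R : nat) (U : cmd) : cmd :=
  ri <-- Reg rp ;;
  While ((Reg ri <! Reg rT) *! (Reg ri +! Const 1 <! Reg rp +! (Reg rh +! Reg rh)))
    (rad <-- Reg roff +! Const 4 *! Reg ri ;;
     rx <-- Peek (Reg rad +! Const 1) ;;
     ry <-- Peek (Reg rad +! Const 2) ;;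
     rad <-- Const 2 *! (Reg rx *! Reg rN +! Reg ry) ;;
     rf <-- Peek (Reg rad) ;;
     rwt <-- Peek (Reg rad +! Const 1) ;;
     rsn <-- Const 0 ;;
     rj <-- Const 0 ;;
     scan directed ;;
     If (Reg rsn <! Reg rf) (call R [:: Reg rx; Reg ry; Reg rwt] U) Skip ;;
     ri <-- Reg ri +! Const 1).

(** The halves are treated from right to left: the slot at [rp], which is [rlo] rounded down to a
    multiple of [2 * rh], serves both the larger interval and its first half, so the second half
    must be copied from it before it is overwritten. *)
Definition level (directed : bool) (R : nat) (U : cmd) : cmd :=
  rlo <-- Reg rK ;;
  While (Reg rlo)
    (rlo <-- Bin OpSub (Reg rlo) (Reg rh) ;;
     rp <-- Bin OpSub (Reg rlo) (Bin OpMod (Reg rlo) (Reg rh +! Reg rh)) ;;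
     rsrc <-- Reg rX +! Reg rp *! Reg rS ;;
     rdst <-- Reg rX +! Reg rlo *! Reg rS ;;
     rlen <-- Reg rS ;;
     copy ;;
     base_reg <-- Reg rdst ;;
     insert_edges directed R U).

(** The root has length [2 * K], so the first pass, with [rh = K], treats the single half starting
    at [0]. The division sends [1] to [0], which ends the loop. *)
Definition build (directed : bool) (R : nat) (U : cmd) : cmd :=
  rh <-- Reg rK ;;
  While (Reg rh) (level directed R U ;; rh <-- Bin OpDiv (Reg rh) (Const 2)).

Definition edge_cost (T R tu : nat) : nat :=
  scan_cost T + call_cost R [:: Reg rx; Reg ry; Reg rwt] tu + 100.

(** With halves of length [h] there are [K / h] of them, each with one copy and fewer than [2 * h]
    updates to examine: at most [K] copies and [2 * K] updates, whatever [h] is. *)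
Definition level_cost (T R tu S K : nat) : nat :=
  K * (16 * S + 2 * edge_cost T R tu + 400) + 20.

Lemma slot_disjoint X S t c a :
  t <> c -> a < S -> ~~ (X + t * S <= X + c * S + a < X + t * S + S).
Proof.
move=> tc aS; case: (ltnP c t) => ct.
  by have : c.+1 * S <= t * S; [rewrite leq_mul2r ct orbT | rewrite mulSn; lia].
have : t.+1 * S <= c * S by rewrite leq_mul2r; apply/orP; right; lia.
by rewrite mulSn; lia.
Qed.

Section Build.

Variables (directed : bool) (W : pred int) (A : oracle) (w n N S X L R tu : nat).
Variables (G : wgraph N) (us : seq (update N)).
Let T := size us.
Let K := 2 ^ L.
Let off := 2 * N * N.

Hypothesis XE : X = 2 * N * N + 4 * size us + 2.
Hypothesis word_bound : 2 * X + 2 ^ L * S + S + 4 * 2 ^ L + 4 < 2 ^ w.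
Hypothesis G_adm : admissible directed W w G.
Hypothesis us_legal : legal_seq directed W w G us.
Hypothesis update_regs : creg (do_update A) <= R.
Hypothesis update_exec : forall (H : wgraph N) m x y z,
  inc_reach directed W A w n H m -> legal directed W w H (Insert x y z) ->
  exists r m' t s, [/\ exec w (do_update A) (cells (insert_args w x y z), m) (r, m') t s,
    t <= tu & s <= S].

Notation regs := (regs n S X K us).
Notation holds_input := (holds_input w X G us).
Notation block := (block directed G us).

(** Agreement on [S] cells suffices, as updates and queries access no others. *)
Definition holds (H : wgraph N) (base : nat) (m : nat -> nat) : Prop :=
  exists vm, inc_reach directed W A w n H vm /\ forall a, a < S -> m (base + a) = vm a.

Lemma runs_insert_edges base h lo p i x y f wt sn j ad src dst len cnt m t Q :
  base = X + lo * S -> p <= lo -> lo + h <= p + h.*2 -> 0 < h -> lo < K ->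
  p + h.*2 <= 3 * K -> holds_input m -> holds (block p h.*2) base m ->
  h.*2 * (edge_cost T R tu + 20) + 20 <= t ->
  (forall m' i x y f wt sn j ad, holds (block lo h) base m' ->
     (forall b, ~~ (base <= b < base + S) -> m' b = m b) ->
     Q (regs base h lo p i x y f wt sn j ad src dst len cnt) m') ->
  runs w (insert_edges directed R (do_update A))
    (regs base h lo p i x y f wt sn j ad src dst len cnt) m t Q.
Proof.
move=> bE pl lh h0 loK pK Hm Hp ht HQ.
have loS : lo * S + S <= K * S by rewrite -mulSnr leq_mul2r loK orbT.
have symG : symmetric_graph directed G := admissible_symmetric G_adm.
have TX : 4 * T < X by rewrite XE /T; lia.
pose cur := transit directed G us p lo h.
have fit : base + S <= 2 ^ w by rewrite bE; move: loS; rewrite /K; lia.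
apply: runs_assign_seq => //=; first lia.
(* The first index past the updates that exist and lie inside the larger interval. *)
pose e0 := minn (p + h.*2).-1 T.
pose Inv k l m' := exists i x y f wt sn j ad,
  [/\ l = regs base h lo p i x y f wt sn j ad src dst len cnt,
      p <= i <= p + h.*2, k = e0 - i, holds (cur i) base m'
    & forall b, ~~ (base <= b < base + S) -> m' b = m b].
apply: (runs_while (Inv := Inv) (c0 := edge_cost T R tu) (k := e0 - p)).
- move=> k l m' [i' [x' [y' [f' [wt' [sn' [j' [ad' [-> pi kE _ _]]]]]]]]] /=.
  have : (i' < T) * (i' + 1 < p + (h + h)) <= 1 by case: (_ < _); case: (_ < _).
  by move: pK loS word_bound; rewrite -/K; lia.
- move=> l m' [i' [x' [y' [f' [wt' [sn' [j' [ad' [-> pi kE _ _]]]]]]]]] /=.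
  case iT: (i' < T) => //=; rewrite mul1n; apply/eqP; rewrite eqb0.
  by move: kE iT; rewrite /e0; lia.
- move=> k l m' [i' [x' [y' [f' [wt' [sn' [j' [ad' [-> pi kE [vm [vmr mvm]] out]]]]]]]]].
  have iT : i' < T by move: kE; rewrite /e0; lia.
  have ih : i'.+1 < p + h.*2 by move: kE; rewrite /e0; lia.
  have ih2 : i' + 1 < p + (h + h) by lia.
  rewrite /= iT ih2; split=> //.
  have Hm' : holds_input m' by move=> b bX; rewrite out ?Hm // bE; lia.
  have [a E] := onth_lt iT.
  have [e1 e2] := update_words_ends w a.
  have r1 : m' (off + 4 * i' + 1) = (ends a).1 by rewrite (input_update XE Hm' E).
  have r2 : m' (off + 4 * i' + 2) = (ends a).2 by rewrite (input_update XE Hm' E).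
  have lt c : c < 4 -> off + 4 * i' + c < 2 ^ w by rewrite /off; move: XE iT; rewrite /T; lia.
  have l1 := lt 1 isT; have l2 := lt 2 isT.
  have uv := cell_lt (ends a).1 (ends a).2.
  have NX : 2 * (N * N) < 2 ^ w by lia.
  have enc0 := encodes_option_words w (G ((ends a).1, (ends a).2)).
  have g1 := input_graph XE (ends a).1 (ends a).2 Hm' (isT : 1 < 2).
  have g0 := input_graph XE (ends a).1 (ends a).2 Hm' (isT : 0 < 2).
  rewrite addn0 in g0; rewrite -g0 -g1 in enc0.
  rewrite /edge_cost.
  apply: runs_assign_seq => /=; [lia|lia|].
  apply: runs_assign_seq => /=; [lia|lia|rewrite r1].
  apply: runs_assign_seq => /=; [lia|lia|rewrite r2].
  apply: runs_assign_seq => /=; [lia|lia|].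
  apply: runs_assign_seq => /=; [lia|lia|].
  apply: runs_assign_seq => /=; [lia|lia|].
  apply: runs_assign_seq => /=; [lia|lia|].
  apply: runs_assign_seq => /=; [lia|lia|].
  set e := ((ends a).1, (ends a).2).
  have eE : e = ends a by rewrite /e -surjective_pairing.
  pose mid l' m'' := m'' = m' /\ exists f wt ad, encodes w (block lo h e) f wt /\
    l' = regs base h lo p i' (ends a).1 (ends a).2 f wt
           (touched directed us p i' e) T ad src dst len cnt.
  apply: (@runs_seq _ (scan_cost T) mid); [|lia|].
    apply: (runs_scan XE _ Hm' enc0) => //; [lia|move: loS word_bound; rewrite -/K; lia|].
    move=> f1 wt1 ad1 enc; split=> //; exists f1, wt1, ad1; split=> //.
    by have -> : minn i' T = i' by lia.
  move=> _ _ [-> [f1 [wt1 [ad1 [enc ->]]]]].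
  pose mid1 l' m'' := l' = regs base h lo p i' (ends a).1 (ends a).2 f1 wt1
           (touched directed us p i' e) T ad1 src dst len cnt /\
    holds (cur i'.+1) base m'' /\ (forall b, ~~ (base <= b < base + S) -> m'' b = m b).
  apply: (@runs_seq _ (call_cost R [:: Reg rx; Reg ry; Reg rwt] tu + 10) mid1); last 2 first.
  + lia.
  + move=> _ m'' [-> [hold out']].
    apply: runs_assign => /=; [lia|lia|].
    eexists _, _, _, _, _, _, _, _; split; [by []|lia|lia|by rewrite addn1|by []].
  apply: runs_if => /=; [lia|lia| |].
  + rewrite eqb0 negbK => sf.
    (* Both registers hold [0] or [1], so [rsn < rf] says that the edge is stable on the half and
       not yet dealt with. *)
    have seen0 : touched directed us p i' (ends a) = false.
      move: sf enc; rewrite eE; case: touched => //=.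
      by case: (block _ _ _) => [z|] /= f1lt; [case|] => f1E; rewrite f1E in f1lt.
    have [z bz] : exists z, block lo h (ends a) = Some z.
      move: enc sf; rewrite eE; case: (block _ _ _) => [z|/= ->] //; by exists z.
    have [fE wtE] : f1 = 1 /\ wt1 = word_of_int w z by move: enc; rewrite eE bz.
    have [pi1 _] := andP pi.
    have none := transit_none G lo pi1 ih E seen0.
    have step := transit_insert (p := p) symG pi1 E seen0 bz.
    have leg : legal directed W w (cur i') (Insert (ends a).1 (ends a).2 z).
      split; first by rewrite /edge -surjective_pairing none.
      rewrite -step; apply: (admissible_sub _ _ (at_time_admissible lo G_adm us_legal)).
        by move=> e' z'; apply: transit_sub.
      exact: transit_sym.
    have [r [vm' [t' [s' [ex tt ss]]]]] := update_exec vmr leg.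
    apply: (runs_call ex update_regs ss tt fit _ mvm) => //.
    * by rewrite /insert_args /= wtE.
    * lia.
    * move=> m'' hin hout; split=> //; split; last by move=> b ob; rewrite hout // out.
      exists vm'; split=> //; rewrite /cur step; exact: inc_insert vmr leg ex.
  + move=> /eqP; rewrite eqb0 -leqNgt => sf.
    apply: runs_skip; first lia.
    have [pi1 _] := andP pi.
    split=> //; split=> //; rewrite /cur (transit_skip symG pi1 ih E).
      by exists vm.
    move: sf enc; rewrite eE; case: touched; first by left.
    by case: (block _ _ _) => [z|] /= f1le; [case=> f1E; rewrite f1E in f1le | right].
- eexists _, _, _, _, _, _, _, _; split; [by []|lia|by []| |by []].
  by rewrite /cur transit_start.
- move: ht; rewrite /=; move: (edge_cost _ _ _) => ec.
  have : e0 - p <= h.*2 by rewrite /e0; lia.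
  move: (e0 - p) => k kh ht.
  by have := leq_mul kh (leqnn (ec + 20)); lia.
- move=> l' m' [i' [x' [y' [f' [wt' [sn' [j' [ad' [-> pi kE hold out]]]]]]]]].
  apply: HQ => //; rewrite -(@transit_end _ _ G us p lo h i') //.
  by move: kE; rewrite /e0 /T; lia.
Qed.

Definition slot (m : nat -> nat) lo h : Prop := holds (block lo h) (X + lo * S) m.

Lemma slot_outside m m' t c h : t <> c ->
  (forall b, ~~ (X + t * S <= b < X + t * S + S) -> m' b = m b) -> slot m c h -> slot m' c h.
Proof.
move=> tc out [vm [vmr mvm]]; exists vm; split=> // a aS.
by rewrite out ?mvm //; apply: slot_disjoint.
Qed.

Lemma input_outside m m' t :
  (forall b, ~~ (X + t * S <= b < X + t * S + S) -> m' b = m b) ->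
  holds_input m -> holds_input m'.
Proof. by move=> out Hm b bX; rewrite out ?Hm //; lia. Qed.

(** The larger interval of the [k]-th half starts at that half if [k] is even and one half earlier
    if [k] is odd. *)
Lemma half_step (k h : nat) : 0 < h ->
  k * h - k * h %% (h + h) = (k - k %% 2) * h.
Proof. by move=> h0; rewrite addnn -mul2n -muln_modl mulnBl. Qed.

Lemma runs_level base h lo p i x y f wt sn j ad src dst len cnt m t Q :
  (exists l, h = 2 ^ l /\ l <= L) -> holds_input m ->
  (forall q, h.*2 %| q -> q < K -> slot m q h.*2) ->
  level_cost T R tu S K <= t ->
  (forall m' base lo p i x y f wt sn j ad src dst len cnt,
     holds_input m' -> (forall q, h %| q -> q < K -> slot m' q h) ->
     Q (regs base h lo p i x y f wt sn j ad src dst len cnt) m') ->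
  runs w (level directed R (do_update A))
    (regs base h lo p i x y f wt sn j ad src dst len cnt) m t Q.
Proof.
move=> [l0 [hE lL]] Hm Hs ht HQ.
have h0 : 0 < h by rewrite hE expn_gt0.
have wb : 2 * X + K * S + S + 4 * K + 4 < 2 ^ w by exact: word_bound.
have KE : K = 2 ^ (L - l0) * h by rewrite hE -expnD subnK.
have hK : h <= K by rewrite hE leq_exp2l.
apply: runs_assign_seq => //=; first by move: ht; rewrite /level_cost; lia.
(* With [k] halves left, the slots from [k * h] on are finished, while those below still hold the
   structures of the larger intervals. *)
pose Inv k l m' := exists base p i x y f wt sn j ad src dst len cnt,
  [/\ l = regs base h (k * h) p i x y f wt sn j ad src dst len cnt,
      k * h <= K, holds_input m',
      forall c, h %| c -> k * h <= c < K -> slot m' c h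
    & forall q, h.*2 %| q -> q < k * h -> slot m' q h.*2].
apply: (runs_while (Inv := Inv) (c0 := 16 * S + h.*2 * (edge_cost T R tu + 20) + 200)
  (k := 2 ^ (L - l0))).
- by move=> k l m' [? [? [? [? [? [? [? [? [? [? [? [? [? [? [-> _ _ _ _]]]]]]]]]]]]]]].
- by move=> l m' [? [? [? [? [? [? [? [? [? [? [? [? [? [? [-> _ _ _ _]]]]]]]]]]]]]]].
- move=> k l m' [b1 [p1 [i1 [x1 [y1 [f1' [wt1 [sn1 [j1 [ad1 [src1 [dst1 [len1 [cnt1
    [-> kK Hm' Hc Hq]]]]]]]]]]]]]]].
  rewrite mulSn in kK Hc Hq *.
  split; first by rewrite /=; lia.
  have loE : h + k * h - h = k * h by lia.
  have [q [qE qk kq sq]] : exists q,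
      [/\ k * h - k * h %% (h + h) = q, q <= k * h, k * h <= q + h & slot m' q h.*2].
    exists ((k - k %% 2) * h); rewrite half_step //.
    have qk : (k - k %% 2) * h <= k * h by rewrite leq_mul2r leq_subr orbT.
    split=> //.
      rewrite -mulSnr leq_mul2r; apply/orP; right.
      by have := ltn_pmod k (isT : 0 < 2); lia.
    apply: Hq; last by lia.
    by apply/dvdnP; exists (k %/ 2); rewrite {1}(divn_eq k 2) addnK -mulnA mul2n.
  have modle : k * h %% (h + h) <= k * h by apply: leq_mod.
  have mqS : q * S <= k * h * S by rewrite leq_mul2r qk orbT.
  have mkS : k * h * S + S <= K * S.
    by rewrite -mulSnr leq_mul2r; apply/orP; right; move: kK h0; clear; lia.
  have f1 : h + k * h < 2 ^ w by move: kK wb; clear; lia.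
  have f2 : h <= h + k * h by exact: leq_addr.
  have f3 : h + h < 2 ^ w by move: hK wb; clear; lia.
  have f4 : k * h < 2 ^ w by move: f1; clear; lia.
  have f5 : q * S < 2 ^ w by move: mqS mkS wb; clear; lia.
  have f6 : X + q * S < 2 ^ w by move: mqS mkS wb; clear; lia.
  have f7 : k * h * S < 2 ^ w by move: mkS wb; clear; lia.
  have f8 : X + k * h * S < 2 ^ w by move: mkS wb; clear; lia.
  have f9 : X + q * S + S < 2 ^ w by move: mqS mkS wb; clear; lia.
  have f10 : X + k * h * S + S < 2 ^ w by move: mkS wb; clear; lia.
  have f11 : 1 < 2 ^ w by move: wb; clear; lia.
  apply: runs_assign_seq => /=; [by rewrite f1 f2|clear; lia|rewrite loE].
  apply: runs_assign_seq => /=; [by rewrite modle|clear; lia|rewrite qE {qE modle}].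
  apply: runs_assign_seq => /=; [by []|clear; lia|].
  apply: runs_assign_seq => /=; [by []|clear; lia|].
  apply: runs_assign_seq => /=; [by []|clear; lia|].
  pose mid l' m'' := [/\ l' = regs b1 h (k * h) q i1 x1 y1 f1' wt1 sn1 j1 ad1
      (X + q * S) (X + k * h * S) S S,
    forall a, a < S -> m'' (X + k * h * S + a) = m' (X + q * S + a)
    & forall b, ~~ (X + k * h * S <= b < X + k * h * S + S) -> m'' b = m' b].
  apply: (@runs_seq _ (16 * S + 20) mid); [|clear; lia|].
    apply: runs_copy => //.
    case: (eqVneq q (k * h)) => [->|ne]; [by left | right; left].
    have : q.+1 * S <= k * h * S by rewrite leq_mul2r; apply/orP; right; move: qk ne; clear; lia.
    by rewrite mulSn; clear; lia.
  move=> _ m1 [-> cp out].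
  apply: runs_assign_seq => /=; [by []|clear; lia|].
  have [vm [vmr mvm]] := sq.
  apply: runs_insert_edges => //.
  + by move: kq; rewrite -addnn; clear; lia.
  + by move: kK h0; clear; lia.
  + by move: qk kK hK; rewrite -addnn; clear; lia.
  + exact: input_outside out Hm'.
  + by exists vm; split=> // a aS; rewrite cp // mvm.
  + by clear; lia.
  + move=> m2 i2 x2 y2 f2' wt2 sn2 j2 ad2 hold out2.
    have out3 b : ~~ (X + k * h * S <= b < X + k * h * S + S) -> m2 b = m' b.
      by move=> ob; rewrite out2 // out.
    do 14! eexists; split; [by []|by move: f2 kK; clear; lia|exact: input_outside out3 Hm'|..].
    (* A multiple of [h] beyond [k * h] is at least [h + k * h], hence was finished before. *)
    * clear f1 f3 f4 f5 f6 f7 f8 f9 f10 f11 mqS mkS wb ht Hq; move=> c hc ckK; case: (eqVneq c (k * h)) => [->//|/eqP ne].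
      have rg : h + k * h <= c < K.
        have [/andP[kc ->] [d dE]] := (ckK, dvdnP hc); rewrite andbT.
        rewrite dE in ne kc *; rewrite leq_pmul2r // in kc.
        rewrite -mulSn leq_pmul2r //.
        by case: (ltngtP k d) kc ne => // ->.
      by apply: slot_outside out3 (Hc c hc rg) => E; apply: ne.
    * move=> c hc ck; have ck' : c < h + k * h by move: ck h0; clear; lia.
      by apply: slot_outside out3 (Hq c hc ck') => E; move: ck; rewrite E ltnn.
- rewrite /Inv -KE; do 14! eexists; split; [by []|by []|by []|by move=> c _ /andP[Kc cK]; move: (leq_trans cK Kc); rewrite ltnn|by []].
- have hk : 2 ^ (L - l0) <= K by rewrite leq_exp2l // leq_subr.
  move: ht; rewrite /level_cost /=; move: (edge_cost _ _ _) => ec.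
  move: (2 ^ (L - l0)) KE hk => k KE hk ht.
  have := leq_mul hk (leqnn (16 * S + 202)).
  have : k * (h.*2 * (ec + 20)) = K * (2 * (ec + 20)) by rewrite KE; lia.
  by lia.
- move=> l m' [b1 [p1 [i1 [x1 [y1 [f1 [wt1 [sn1 [j1 [ad1 [src1 [dst1 [len1 [cnt1
    [-> kK Hm' Hc Hq]]]]]]]]]]]]]]].
  by apply: HQ => // c hc cK; apply: Hc.
Qed.

Lemma runs_build base h lo p i x y f wt sn j ad src dst len cnt m t Q :
  holds_input m -> slot m 0 K.*2 ->
  L.+2 * (level_cost T R tu S K + 10) + 10 <= t ->
  (forall m' base h lo p i x y f wt sn j ad src dst len cnt,
     (forall q, q < K -> slot m' q 1) ->
     Q (regs base h lo p i x y f wt sn j ad src dst len cnt) m') ->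
  runs w (build directed R (do_update A))
    (regs base h lo p i x y f wt sn j ad src dst len cnt) m t Q.
Proof.
move=> Hm H0 ht HQ.
have wb : 2 * X + K * S + S + 4 * K + 4 < 2 ^ w by exact: word_bound.
apply: runs_assign_seq => //=; [lia|].
(* The content of [rh] when [k] levels remain; the slots then hold intervals of length [2 ^ k],
   twice that content as long as [k] is positive. *)
pose hk k := if k is k'.+1 then 2 ^ k' else 0.
pose Inv k l m' := exists base lo p i x y f wt sn j ad src dst len cnt,
  [/\ l = regs base (hk k) lo p i x y f wt sn j ad src dst len cnt,
      k <= L.+1, holds_input m'
    & forall q, 2 ^ k %| q -> q < K -> slot m' q (2 ^ k)].
apply: (runs_while (Inv := Inv) (c0 := level_cost T R tu S K + 4) (k := L.+1)).
- by move=> k l m' [? [? [? [? [? [? [? [? [? [? [? [? [? [? [? [-> _ _ _]]]]]]]]]]]]]]]].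
- by move=> l m' [? [? [? [? [? [? [? [? [? [? [? [? [? [? [? [-> _ _ _]]]]]]]]]]]]]]]].
- move=> k l m' [b1 [lo1 [p1 [i1 [x1 [y1 [f1 [wt1 [sn1 [j1 [ad1 [src1 [dst1 [len1 [cnt1
    [-> kL Hm' Hs]]]]]]]]]]]]]]]].
  have kK : 2 ^ k <= K by rewrite leq_exp2l.
  split; first by rewrite /=; have := expn_gt0 2 k; lia.
  pose mid l' m'' := exists base lo p i x y f wt sn j ad src dst len cnt,
    [/\ l' = regs base (2 ^ k) lo p i x y f wt sn j ad src dst len cnt,
      holds_input m'' & forall q, 2 ^ k %| q -> q < K -> slot m'' q (2 ^ k)].
  apply: (@runs_seq _ (level_cost T R tu S K) mid); [|lia|].
    apply: runs_level => //.
    + by exists k.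
    + by move=> q; rewrite -mul2n -expnS; apply: Hs.
    + by move=> m2 *; do 15! eexists; split.
  move=> _ m2 [b2 [lo2 [p2 [i2 [x2 [y2 [f2 [wt2 [sn2 [j2 [ad2 [src2 [dst2 [len2 [cnt2
    [-> Hm2 Hs2]]]]]]]]]]]]]]]].
  apply: runs_assign => /=; [lia|lia|].
  have -> : 2 ^ k %/ 2 = hk k.
    by case: k {kL Hs kK mid Hs2} => [|k] //=; rewrite expnS mulKn.
  by do 15! eexists; split; [by []|lia|by []|by []].
- do 15! eexists; split; [by []|by []|by []|].
  (* The only multiple of [2 * K] below [K] is [0], the slot of the root. *)
  move=> q /dvdnP[d ->] dK; have -> : d = 0.
    move: dK; rewrite expnS -/K; case: d => // d; rewrite mulSn; have := expn_gt0 2 L; rewrite -/K; lia.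
  by rewrite mul0n expnS mul2n.
- by move: ht; rewrite /=; move: (level_cost _ _ _ _ _) => lc; lia.
- move=> l m' [b1 [lo1 [p1 [i1 [x1 [y1 [f1 [wt1 [sn1 [j1 [ad1 [src1 [dst1 [len1 [cnt1
    [-> kL Hm' Hs]]]]]]]]]]]]]]]].
  by apply: HQ => q qK; apply: Hs; rewrite ?expn0.
Qed.

End Build.

(** * The whole preprocessing program and the online operations *)

Definition power_above (x c lim : nat) : cmd :=
  x <-- Const 1 ;;
  c <-- Const 0 ;;
  While (Reg x <! Reg lim +! Const 1)
    (x <-- Reg x +! Reg x ;; c <-- Reg c +! Const 1).

(** An upper bound on the space of the incremental oracle that a program can compute, [a] and [b]
    being the constants of its soft-O bound. The successor keeps it positive, so that it also bounds
    all intermediate products. *)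
Definition slot_size (a b n lg : nat) : nat := lg ^ b * (a.+1 * (n * n)).

Definition slot_size_expr (a b : nat) : expr :=
  iter b (Bin OpMul (Reg rlo)) (Const a.+1 *! (Reg rn *! Reg rn)).

(* The slot for time [t] starts at address [X + t * S].  In the end, cell [0]
   holds the address of the current slot and cell [1] the size [S] of a slot. *)
Definition offline_preprocess (directed : bool) (R a b : nat) (A : oracle) : cmd :=
  power_above rK rp rT ;;
  power_above rh rlo rn ;;
  rS <-- slot_size_expr a b ;;
  roff <-- Const 2 *! Reg rN *! Reg rN ;;
  rX <-- Reg roff +! Const 4 *! Reg rT +! Const 2 ;;
  rsrc <-- Const 0 ;;
  rdst <-- Reg rX ;;
  rlen <-- Reg roff ;;
  copy ;;
  clear directed ;;
  base_reg <-- Reg rX ;;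
  call R [:: Reg rn; Reg rN] (preprocess A) ;;
  build directed R (do_update A) ;;
  Poke (Const 0) (Reg rX) ;;
  Poke (Const 1) (Reg rS).

Definition offline_update : cmd :=
  Poke (Const 0) (Peek (Const 0) +! Peek (Const 1)).

(** The answer is moved from the shifted registers to registers [0] and [1]. *)
Definition offline_query (R : nat) (A : oracle) : cmd :=
  base_reg <-- Peek (Const 0) ;;
  call R [:: Reg 0; Reg 1; Reg 2; Reg 3] (query A) ;;
  0 <-- Reg own ;;
  1 <-- Reg (own + 1).

Definition offline_preprocess_cost (R b N T S K L lg tp tu : nat) : nat :=
  20 * L + 20 * lg + 2 * b + 32 * (N * N) + 200 * T +
  call_cost R [:: Reg rn; Reg rN] tp +
  L.+2 * (level_cost T R tu S K + 10) + 300.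

Lemma runs_power_above w x c lim L l m t Q :
  x != c -> x != lim -> c != lim -> x < own -> c < own -> lim < own ->
  nth 0 l lim < 2 ^ L -> (forall j, j < L -> 2 ^ j <= nth 0 l lim) ->
  2 * nth 0 l lim + 2 < 2 ^ w -> 20 * L + 20 <= t ->
  Q (set_nth 0 (set_nth 0 l x (2 ^ L)) c L) m ->
  runs w (power_above x c lim) l m t Q.
Proof.
move=> xc xl cl xo co lo vL Lmin vw ht HQ.
have cx : (c == x) = false by rewrite eq_sym (negbTE xc).
have lc : (lim == c) = false by rewrite eq_sym (negbTE cl).
have lx : (lim == x) = false by rewrite eq_sym (negbTE xl).
pose st A j := set_nth 0 (set_nth 0 l x A) c j.
have stx A j : nth 0 (st A j) x = A.
  by rewrite /st nth_set_nth /= (negbTE xc) nth_set_nth /= eqxx.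
have stc A j : nth 0 (st A j) c = j by rewrite /st nth_set_nth /= eqxx.
have stl A j : nth 0 (st A j) lim = nth 0 l lim.
  by rewrite /st nth_set_nth /= lc nth_set_nth /= lx.
have setx A j B : set_nth 0 (st A j) x B = st B j.
  rewrite /st [LHS]set_set_nth cx.
  by rewrite [set_nth 0 (set_nth 0 l x _) x _]set_set_nth eqxx.
have setc A j i : set_nth 0 (st A j) c i = st A i.
  by rewrite /st set_set_nth eqxx.
have w1 : 1 < 2 ^ w by move: vw; clear; lia.
apply: runs_assign_seq => /=; [by []|by move: ht; clear; lia|].
apply: runs_assign_seq => /=; [by rewrite expn_gt0|by move: ht; clear; lia|].
rewrite -/(st 1 0).
pose Inv k l' m' := [/\ k <= L, l' = st (2 ^ (L - k)) (L - k) & m' = m].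
apply: (runs_while (Inv := Inv) (c0 := 10) (k := L)).
- move=> k l' m' [kL -> _] /=; rewrite stl.
  by move: vw xo lo; clear; lia.
- by move=> l' m' [_ -> _] /=; rewrite stx stl subn0 addn1 ltnS leqNgt vL.
- move=> k l' m' [kL -> ->].
  have jL : L - k.+1 < L by move: kL; clear; lia.
  have jE : L - k = (L - k.+1).+1 by move: kL; clear; lia.
  move: (L - k.+1) jL jE => j jL jE.
  have jv := Lmin j jL.
  rewrite /= stx stl addn1 ltnS jv; split=> //.
  apply: runs_assign_seq => /=; rewrite ?stx ?setx //.
    by move: xo jv vw; clear; lia.
  apply: runs_assign => /=; rewrite ?stc ?setc //.
    by have := ltn_expl j (isT : 1 < 2); move: co jv vw; clear; lia.
  by rewrite addn1 addnn -mul2n -expnS -jE; split=> //; apply: ltnW.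
- by rewrite /Inv subnn.
- by move: ht; rewrite /=; clear; lia.
- by move=> l' m' [_ -> ->]; rewrite subn0.
Qed.

Lemma slot_size_exprP w a b n l m lg :
  nth 0 l rlo = lg -> nth 0 l rn = n -> 0 < lg -> 0 < n ->
  slot_size a b n lg < 2 ^ w ->
  [/\ safe (2 ^ w) l m (slot_size_expr a b),
      value l m (slot_size_expr a b) = slot_size a b n lg
    & esize (slot_size_expr a b) = 2 * b + 5].
Proof.
rewrite /slot_size /slot_size_expr => lE nE lg0 n0.
elim: b => [|b IH] Sw.
  rewrite expn0 mul1n in Sw; rewrite /= nE expn0 mul1n; split=> //.
  have le1 : a.+1 <= a.+1 * (n * n) by rewrite leq_pmulr // muln_gt0 n0.
  have le2 : n * n <= a.+1 * (n * n) by rewrite leq_pmull.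
  by rewrite (leq_ltn_trans le1) // (leq_ltn_trans le2).
have le : lg ^ b * (a.+1 * (n * n)) <= lg ^ b.+1 * (a.+1 * (n * n)).
  by rewrite leq_mul2r leq_pexp2l ?orbT.
have [s1 v1 e1] := IH (leq_ltn_trans le Sw).
rewrite iterS /= lE v1 e1 mulnA -expnS; split=> //; by clear; lia.
Qed.

Lemma half_cell a c : (a == 2 * c) || (a == 2 * c + 1) = (a./2 == c).
Proof. by apply/orP/eqP => [[/eqP ->|/eqP ->]|<-]; lia. Qed.

Lemma set_two_cells m X c a :
  set_cell (set_cell m (X + 2 * c) 0) (X + 2 * c + 1) 0 (X + a) =
  if a./2 == c then 0 else m (X + a).
Proof.
rewrite /set_cell -half_cell -addnA !eqn_add2l.
by case: (a == 2 * c); case: (a == 2 * c + 1).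
Qed.

Lemma set_two_cells_below m X c b : b < X ->
  set_cell (set_cell m (X + 2 * c) 0) (X + 2 * c + 1) 0 b = m b.
Proof. by move=> bX; rewrite /set_cell !ifN //; lia. Qed.

Section Preprocess.

Variables (directed : bool) (W : pred int) (A : oracle).
Variables (w n N R a b L lg tp tu : nat) (G : wgraph N) (us : seq (update N)).
Let T := size us.
Let K := 2 ^ L.
Let S := slot_size a b n lg.
Let off := 2 * N * N.
Let X := 2 * N * N + 4 * size us + 2.

Hypothesis n_gt0 : 0 < n.
Hypothesis lg_gt0 : 0 < lg.
Hypothesis word_bound :
  2 * X + 2 ^ L * S + S + tp + 4 * 2 ^ L + 4 + 2 * n < 2 ^ w.
Hypothesis L_above : T < 2 ^ L.
Hypothesis L_least : forall j, j < L -> 2 ^ j <= T.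
Hypothesis lg_above : n < 2 ^ lg.
Hypothesis lg_least : forall j, j < lg -> 2 ^ j <= n.
Hypothesis G_adm : admissible directed W w G.
Hypothesis us_legal : legal_seq directed W w G us.
Hypothesis preprocess_regs : creg (preprocess A) <= R.
Hypothesis update_regs : creg (do_update A) <= R.
Hypothesis preprocess_exec : forall H : wgraph N, admissible directed W w H ->
  exists r m t s, [/\ exec w (preprocess A) (cells [:: n; N], cells (graph_words w H)) (r, m) t s,
    t <= tp & s <= tp].
Hypothesis update_exec : forall (H : wgraph N) m x y z,
  inc_reach directed W A w n H m -> legal directed W w H (Insert x y z) ->
  exists r m' t s, [/\ exec w (do_update A) (cells (insert_args w x y z), m) (r, m') t s,
    t <= tu & s <= S].

Notation regs := (regs n S X K us).
Notation holds_input := (holds_input w X G us).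

Let XE : X = off + 4 * T + 2. Proof. by []. Qed.

(** Every cell from [X] on is described, because the incremental preprocessing expects zeros beyond
    the encoded graph. *)
Lemma runs_clear base h lo p i x y f wt sn j ad src dst len cnt m t Q :
  holds_input m -> (forall c, m (X + c) = cells (graph_words w G) c) ->
  200 * T + 20 <= t ->
  (forall m' i x y ad, holds_input m' ->
     (forall c, m' (X + c) = cells (graph_words w (cleared directed G us)) c) ->
     Q (regs base h lo p i x y f wt sn j ad src dst len cnt) m') ->
  runs w (clear directed)
    (regs base h lo p i x y f wt sn j ad src dst len cnt) m t Q.
Proof.
move=> Hm Hg ht HQ.
have wb : 2 * X + 4 < 2 ^ w by move: word_bound; clear; lia.
apply: runs_assign_seq => /=; [by move: wb; clear; lia|by move: ht; clear; lia|].
pose Inv k l m' := exists i x y ad,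
  [/\ l = regs base h lo p i x y f wt sn j ad src dst len cnt,
      k = T - i /\ i <= T, holds_input m'
    & forall c, m' (X + c) = cells (graph_words w (cleared directed G (take i us))) c].
apply: (runs_while (Inv := Inv) (c0 := 100) (k := T)).
- move=> k l m' [i' [x' [y' [ad' [-> [_ iT] _ _]]]]] /=.
  by move: wb; clear; lia.
- move=> l m' [i' [x' [y' [ad' [-> [k0 iT] _ _]]]]] /=.
  by apply/eqP; rewrite eqb0 -leqNgt; move: k0; rewrite -/T; clear; lia.
- move=> k l m' [i' [x' [y' [ad' [-> [kE _] Hm' Hg']]]]].
  have iT : i' < T by move: kE; clear; lia.
  split; first by rewrite /= iT.
  have [u E] := onth_lt iT.
  have [e1 e2] := update_words_ends w u.
  have r1 : m' (off + 4 * i' + 1) = (ends u).1 by rewrite (input_update XE Hm' E).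
  have r2 : m' (off + 4 * i' + 2) = (ends u).2 by rewrite (input_update XE Hm' E).
  have gS c : cells (graph_words w (cleared directed G (take i'.+1 us))) c =
      if (c./2 == (ends u).1 * N + (ends u).2) ||
         ~~ directed && (c./2 == (ends u).2 * N + (ends u).1) then 0 else m' (X + c).
    rewrite (take_nth u) // (@onth_nth _ u _ _ _ E) /cleared foldl_rcons.
    by rewrite graph_words_clear -Hg'.
  have lt c : c < 4 -> off + 4 * i' + c < 2 ^ w by move: XE wb iT; clear; lia.
  have lt1 := lt 1 isT; have lt2 := lt 2 isT.
  have fit (v v' : 'I_N) :
      [/\ v * N < 2 ^ w, v * N + v' < 2 ^ w, 2 * (v * N + v') < 2 ^ w,
          X + 2 * (v * N + v') < 2 ^ w & X + 2 * (v * N + v') + 1 < 2 ^ w].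
    have vv := cell_lt v v'; have : 2 * (v * N + v') + 2 <= X.
      by rewrite XE /off -mulnA; move: vv; clear; lia.
    by move: wb; clear; split; lia.
  have [v1 v2 v3 v4 v5] := fit (ends u).1 (ends u).2.
  have [v1' v2' v3' v4' v5'] := fit (ends u).2 (ends u).1.
  have [w1 w2 w4] : [/\ 1 < 2 ^ w, 2 < 2 ^ w & 4 < 2 ^ w] by move: wb; clear; split; lia.
  have w0 : 0 < 2 ^ w by rewrite expn_gt0.
  have o1 : off + 4 * i' < 2 ^ w by move: lt1; clear; lia.
  have o2 : 4 * i' < 2 ^ w by move: lt1; clear; lia.
  apply: runs_assign_seq => /=; [by []|by clear; lia|].
  apply: runs_assign_seq => /=; [by []|by clear; lia|rewrite r1].
  apply: runs_assign_seq => /=; [by []|by clear; lia|rewrite r2].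
  apply: runs_assign_seq => /=; [by []|by clear; lia|].
  apply: runs_poke_seq => /=; [by []|by []|by clear; lia|].
  apply: runs_poke_seq => /=; [by []|by []|by clear; lia|].
  pose mid l' m'' := exists ad,
    [/\ l' = regs base h lo p i' (ends u).1 (ends u).2 f wt sn j ad src dst len cnt,
        forall b, b < X -> m'' b = m' b
      & forall c, m'' (X + c) = cells (graph_words w (cleared directed G (take i'.+1 us))) c].
  apply: (@runs_seq _ 30 mid); [|by clear; lia|].
  + case: ifPn => dT.
      apply: runs_skip => //; eexists; split; first by [].
        by move=> d dX; rewrite set_two_cells_below.
      by move=> c; rewrite set_two_cells gS dT orbF.
    apply: runs_assign_seq => /=; [by []|by clear; lia|].
    apply: runs_poke_seq => /=; [by []|by []|by clear; lia|].
    apply: runs_poke => /=; [by []|by []|by clear; lia|].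
    eexists; split; first by [].
      by move=> d dX; rewrite !set_two_cells_below.
    by move=> c; rewrite !set_two_cells gS dT; do 2! case: eqP.
  + move=> _ m'' [ad1 [-> below above]].
    have i1 : i' + 1 < 2 ^ w by move: o2 w1; clear; lia.
    apply: runs_assign => /=; [by []|by clear; lia|].
    eexists _, _, _, _; rewrite addn1; split; [by []| | |exact: above].
      by move: kE iT; clear; lia.
    by move=> d dX; rewrite below ?Hm'.
- by eexists _, _, _, _; split; [by []|by rewrite subn0|by []|by rewrite take0].
- by move: ht; rewrite /= -/T; clear; lia.
- move=> l m' [i' [x' [y' [ad' [-> [k0 iT] Hm' Hg']]]]].
  by apply: HQ => // c; rewrite Hg' take_oversize // -/T; move: k0; clear; lia.
Qed.

Lemma runs_offline_preprocess Q :
  (forall l m, m 0 = X -> m 1 = S ->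
     (forall q, q <= T -> holds directed W A w n S (at_time directed G us q) (X + q * S) m) ->
     Q l m) ->
  runs w (offline_preprocess directed R a b A)
    [:: n; N; T; 0; 0; 0; 0; 0; 0; 0; 0; 0; 0; 0; 0; 0; 0; 0; 0; 0; 0; 0; 0]
    (off_input w n G us).2
    (offline_preprocess_cost R b N T S K L lg tp tu) Q.
Proof.
move=> HQ; rewrite /offline_preprocess_cost.
have KT : 2 * K <= 4 * T + 2.
  rewrite /K; case: (L) L_least => [|k] Lk; first by rewrite expn0; clear; lia.
  by rewrite expnS; have := Lk k (leqnn _); clear; lia.
have NN : off = 2 * (N * N) by rewrite /off mulnA.
have off2 : 2 * N <= off by rewrite NN leq_mul2l; case: (N) => // k; rewrite leq_pmulr.
have wb : 2 * X + K * S + S + tp + 4 * K + 4 + 2 * n < 2 ^ w by [].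
have [w0 w1 w2 w4] : [/\ 0 < 2 ^ w, 1 < 2 ^ w, 2 < 2 ^ w & 4 < 2 ^ w].
  by move: wb; clear; split; lia.
have [f1 f2 f3] : [/\ 2 * T + 2 < 2 ^ w, 2 * n + 2 < 2 ^ w & 2 * N < 2 ^ w].
  by move: wb XE off2; clear; split; lia.
have [f4 f5 f6 f7] : [/\ off < 2 ^ w, 4 * T < 2 ^ w, off + 4 * T < 2 ^ w & X < 2 ^ w].
  by move: wb XE off2; clear; split; lia.
set bc := L.+2 * _.
set cc := call_cost _ _ _.
apply: (@runs_seq _ (20 * L + 20) (fun l m => l =
  [:: n; N; T; 0; 0; 0; K; 0; 0; 0; L; 0; 0; 0; 0; 0; 0; 0; 0; 0; 0; 0; 0] /\ m = (off_input w n G us).2)).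
- exact: (@runs_power_above _ _ _ _ L).
- by clear; lia.
move=> _ _ [-> ->].
apply: (@runs_seq _ (20 * lg + 20) (fun l m => l =
  [:: n; N; T; 0; 0; 0; K; 0; 2 ^ lg; lg; L; 0; 0; 0; 0; 0; 0; 0; 0; 0; 0; 0; 0] /\ m = (off_input w n G us).2)).
- exact: (@runs_power_above _ _ _ _ lg).
- by clear; lia.
move=> _ _ [-> ->].
have Sw : slot_size a b n lg < 2 ^ w by move: wb; rewrite -/S; clear; lia.
have [s1 v1 z1] := @slot_size_exprP w a b n
  [:: n; N; T; 0; 0; 0; K; 0; 2 ^ lg; lg; L; 0; 0; 0; 0; 0; 0; 0; 0; 0; 0; 0; 0]
  (off_input w n G us).2 lg erefl erefl lg_gt0 n_gt0 Sw.
apply: runs_assign_seq => //; rewrite ?z1; first by clear; lia.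
rewrite v1 -/S /=.
apply: runs_assign_seq => /=; [by rewrite -/off|by clear; lia|].
apply: runs_assign_seq => /=; [by rewrite -/off|by clear; lia|].
apply: runs_assign_seq => /=; [by []|by clear; lia|].
apply: runs_assign_seq => /=; [by rewrite -/X|by clear; lia|].
apply: runs_assign_seq => /=; [by []|by clear; lia|].
rewrite -/off -/X.
pose mid l m := exists base h lo p i x y f wt sn j ad src dst len cnt,
  [/\ l = regs base h lo p i x y f wt sn j ad src dst len cnt, holds_input m
    & forall c, m (X + c) = cells (graph_words w G) c].
apply: (@runs_seq _ (16 * off + 20) mid); [|by rewrite NN; clear; lia|].
  apply: (@runs_copy _ _ _ S X K us) => //.
  - by right; left; rewrite -/off; move: XE; clear; lia.
  - by rewrite -/off; move: XE wb; clear; lia.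
  move=> m' hin hout; do 16! eexists; split; first by [].
    by move=> d dX; rewrite hout // negb_and -ltnNge dX.
  move=> c; case: (ltnP c off) => cO.
    by rewrite hin // /cells nth_cat size_graph_words -/off cO.
  (* Beyond the copied graph both sides are zero, as the input ends below [X]. *)
  rewrite hout; last by rewrite -/off; move: cO; clear; lia.
  rewrite /cells !nth_default //; first by rewrite size_graph_words.
  by rewrite size_cat size_graph_words size_updates -/off -/T; move: XE; clear; lia.
move=> _ m [b1 [h1 [lo1 [p1 [i1 [x1 [y1 [fl1 [wt1 [sn1 [j1 [ad1 [src1 [dst1 [len1 [cnt1
  [-> Hm Hg]]]]]]]]]]]]]]]]].
pose mid1 l m := exists base h lo p i x y f wt sn j ad src dst len cnt,
  [/\ l = regs base h lo p i x y f wt sn j ad src dst len cnt, holds_input m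
    & forall c, m (X + c) = cells (graph_words w (cleared directed G us)) c].
apply: (@runs_seq _ (200 * T + 20) mid1); [|by rewrite NN; clear; lia|].
  apply: runs_clear => // *; by do 16! eexists; split.
move=> _ m2 [b2 [h2 [lo2 [p2 [i2 [x2 [y2 [fl2 [wt2 [sn2 [j2 [ad2 [src2 [dst2 [len2 [cnt2
  [-> Hm2 Hg2]]]]]]]]]]]]]]]]].
apply: runs_assign_seq => /=; [by []|by rewrite NN; clear; lia|].
have cE : cleared directed G us = block directed G us 0 K.*2.
  by rewrite block_all //; move: L_above; rewrite -/T /K -addnn; clear; lia.
have H_adm : admissible directed W w (cleared directed G us).
  rewrite cE; apply: admissible_sub G_adm.
    by move=> e z; rewrite ffunE; case: ifP => //; rewrite /at_time take0.
  apply: block_sym; exact: admissible_symmetric G_adm.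
have [r [vm [t [s [ex tt ss]]]]] := preprocess_exec H_adm.
pose mid2 l m := exists base h lo p i x y f wt sn j ad src dst len cnt,
  [/\ l = regs base h lo p i x y f wt sn j ad src dst len cnt, holds_input m
    & holds directed W A w n S (block directed G us 0 K.*2) (X + 0 * S) m].
apply: (@runs_seq _ cc mid2); [|by rewrite NN; clear; lia|].
  (* The preprocessing may need more scratch space than one slot, and memory above [X] is still
     free. A window of [tp + S] cells covers both that space and the first slot; later slots are
     overwritten by copies. *)
  have ss' : s <= tp + S by exact: leq_trans ss (leq_addr _ _).
  have fit : X + (tp + S) <= 2 ^ w by move: wb; clear; lia.
  apply: (runs_call (l := regs X h2 lo2 p2 i2 x2 y2 fl2 wt2 sn2 j2 ad2 src2 dst2 len2 cnt2)
    ex preprocess_regs ss' tt fit) => //.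
  move=> m' hin hout; do 16! eexists; split; first by [].
    by move=> d dX; rewrite hout ?Hm2 // negb_and -ltnNge dX.
  exists vm; split; first by rewrite -cE; exact: inc_preprocess H_adm ex.
  by move=> c cS; rewrite mul0n addn0 hin // (leq_trans cS) // leq_addl.
move=> _ m3 [b3 [h3 [lo3 [p3 [i3 [x3 [y3 [fl3 [wt3 [sn3 [j3 [ad3 [src3 [dst3 [len3 [cnt3
  [-> Hm3 Hs3]]]]]]]]]]]]]]]]].
pose mid3 l m := exists base h lo p i x y f wt sn j ad src dst len cnt,
  l = regs base h lo p i x y f wt sn j ad src dst len cnt /\
  forall q, q < K -> slot directed W A w n S X G us m q 1.
apply: (@runs_seq _ (bc + 10) mid3); [|by rewrite NN; clear; lia|].
  apply: (@runs_build directed W A w n N S X L R tu G us) => //.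
  - by move: wb; rewrite -/K; clear; lia.
  by move=> *; do 16! eexists; split.
move=> _ m4 [b4 [h4 [lo4 [p4 [i4 [x4 [y4 [fl4 [wt4 [sn4 [j4 [ad4 [src4 [dst4 [len4 [cnt4
  [-> Hs4]]]]]]]]]]]]]]]]].
apply: runs_poke_seq => /=; [by []|by []|by rewrite NN; clear; lia|].
apply: runs_poke => /=; [by []|by []|by rewrite NN; clear; lia|].
apply: HQ => // q qT.
have [|v [vr vm4]] := Hs4 q; first exact: leq_ltn_trans qT L_above.
exists v; split; first by rewrite -block_single.
by move=> c cS; rewrite -vm4 // /set_cell !ifN //; move: XE; clear; lia.
Qed.

End Preprocess.

(** * Asymptotic bounds *)

Section Asymptotics.

Definition lg (n : nat) : nat := (trunc_log 2 n).+1.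

Definition soft_poly (f : nat -> nat) (k : nat) : Prop := soft_O f (fun n => n ^ k).

Lemma soft_poly_le f g k : (forall n, 0 < n -> f n <= g n) -> soft_poly g k -> soft_poly f k.
Proof.
by move=> fg [a [b H]]; exists a, b => n n0; apply: leq_trans (fg n n0) (H n n0).
Qed.

Lemma soft_poly_deg f i k : i <= k -> soft_poly f i -> soft_poly f k.
Proof.
move=> ik [a [b H]]; exists a, b => n n0; apply: leq_trans (H n n0) _.
by rewrite leq_mul2r leq_mul2l leq_pexp2l ?orbT.
Qed.

Lemma soft_poly_add f g k : soft_poly f k -> soft_poly g k -> soft_poly (fun n => f n + g n) k.
Proof.
move=> [a [b H]] [a' [b' H']]; exists (a + a'), (b + b') => n n0.
rewrite !mulnDl leq_add //.
  apply: leq_trans (H n n0) _; rewrite leq_mul2l; apply/orP; right.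
  by rewrite leq_pexp2l // leq_addr.
apply: leq_trans (H' n n0) _; rewrite leq_mul2l; apply/orP; right.
by rewrite leq_pexp2l // leq_addl.
Qed.

Lemma soft_poly_mul i j f g k :
  i + j <= k -> soft_poly f i -> soft_poly g j -> soft_poly (fun n => f n * g n) k.
Proof.
move=> ijk [a [b H]] [a' [b' H']]; apply: (soft_poly_deg ijk).
exists (a * a'), (b + b') => n n0; apply: leq_trans (leq_mul (H n n0) (H' n n0)) _.
by rewrite !expnD mulnACA leq_mul // mulnACA.
Qed.

Lemma soft_poly_const c k : soft_poly (fun=> c) k.
Proof. by apply: (soft_poly_deg (leq0n k)); exists c, 0 => n _; rewrite !muln1. Qed.

Lemma soft_poly_id k : 0 < k -> soft_poly id k.
Proof. by move=> k0; apply: (soft_poly_deg k0); exists 1, 0 => n _; rewrite expn1 mul1n muln1. Qed.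

Lemma soft_poly_lg k : soft_poly lg k.
Proof. by apply: (soft_poly_deg (leq0n k)); exists 1, 1 => n _; rewrite expn1 !mul1n. Qed.

Lemma soft_poly_lg_exp b k : soft_poly (fun n => lg n ^ b) k.
Proof. by apply: (soft_poly_deg (leq0n k)); exists 1, b => n _; rewrite !mul1n. Qed.

Lemma lg_ltn n : n < 2 ^ lg n. Proof. exact: trunc_log_ltn. Qed.

Lemma lg_least n j : 0 < n -> j < lg n -> 2 ^ j <= n.
Proof.
move=> n0 jl; apply: leq_trans (trunc_logP (isT : 1 < 2) n0).
by rewrite leq_exp2l.
Qed.

(** Each of the factors [a], [n ^ k] and [lg n ^ b] is at most [2] to a constant multiple of [lg n];
    so all addresses fit into words of logarithmic size. *)
Lemma soft_poly_word f k :
  soft_poly f k -> exists c, forall n, 0 < n -> f n < 2 ^ (c * lg n).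
Proof.
move=> [a [b H]]; exists (a + k + b) => n n0; apply: leq_ltn_trans (H n n0) _.
rewrite !mulnDl !expnD; apply: leq_ltn_trans (_ : _ <= a * 2 ^ (k * lg n) * 2 ^ (b * lg n)) _.
  apply: leq_mul; first apply: leq_mul => //.
    by rewrite mulnC expnM; case: k {H} => // k; rewrite leq_exp2r // ltnW ?lg_ltn.
  rewrite mulnC expnM; case: b {H} => // b; rewrite leq_exp2r //.
  by rewrite ltnW // ltn_expl.
rewrite !ltn_pmul2r ?expn_gt0 //; apply: leq_trans (ltn_expl a (isT : 1 < 2)) _.
by rewrite leq_exp2l // leq_pmulr.
Qed.

Lemma least_power T : exists L, T < 2 ^ L /\ forall j, j < L -> 2 ^ j <= T.
Proof.
have ex : exists L, T < 2 ^ L by exists T; exact: ltn_expl.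
case: (ex_minnP ex) => L TL Lmin; exists L; split=> // j jL.
by rewrite leqNgt; apply: contraL jL => /Lmin; rewrite -leqNgt.
Qed.

End Asymptotics.

(** * The offline oracle *)

Section Offline.

Variables (directed : bool) (W : pred int) (A : oracle).
Variables (w n N R a b L tp tu tq : nat) (G : wgraph N) (us : seq (update N)).
Let T := size us.
Let K := 2 ^ L.
Let S := slot_size a b n (lg n).
Let X := 2 * N * N + 4 * size us + 2.

Hypothesis n_gt0 : 0 < n.
Hypothesis word_bound :
  2 * X + 2 ^ L * S + S + tp + 4 * 2 ^ L + 4 + 2 * n < 2 ^ w.
Hypothesis L_above : T < 2 ^ L.
Hypothesis L_least : forall j, j < L -> 2 ^ j <= T.
Hypothesis G_adm : admissible directed W w G.
Hypothesis us_legal : legal_seq directed W w G us.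
Hypothesis R_ge2 : 2 <= R.
Hypothesis preprocess_regs : creg (preprocess A) <= R.
Hypothesis update_regs : creg (do_update A) <= R.
Hypothesis query_regs : creg (query A) <= R.
Hypothesis preprocess_exec : forall H : wgraph N, admissible directed W w H ->
  exists r m t s, [/\ exec w (preprocess A) (cells [:: n; N], cells (graph_words w H)) (r, m) t s,
    t <= tp & s <= tp].
Hypothesis update_exec : forall (H : wgraph N) m x y z,
  inc_reach directed W A w n H m -> legal directed W w H (Insert x y z) ->
  exists r m' t s, [/\ exec w (do_update A) (cells (insert_args w x y z), m) (r, m') t s,
    t <= tu & s <= S].
Hypothesis query_exec : forall (H : wgraph N) m u v x y,
  inc_reach directed W A w n H m -> edge H x y ->
  exists r m' t s, [/\ exec w (query A) (cells (query_args u v x y), m) (r, m') t s,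
    t <= tq, s <= S & correct_answer directed w H u v x y r].

Let offline : oracle :=
  Oracle (offline_preprocess directed R a b A) offline_update (offline_query R A).

Let prep_cost := offline_preprocess_cost R b N T S K L (lg n) tp tu.

Definition query_cost (R tq : nat) : nat :=
  call_cost R [:: Reg 0; Reg 1; Reg 2; Reg 3] tq + 10.

(** The invariant of the online phase after [k] updates, preserved by queries although they may
    write to their slot. *)
Definition ready (k : nat) (m : nat -> nat) : Prop :=
  [/\ k <= T, m 0 = X + k * S, m 1 = S
    & forall q, q <= T -> holds directed W A w n S (at_time directed G us q) (X + q * S) m].

Lemma slots_fit k : k <= T -> X + k * S + S < 2 ^ w.
Proof.
move=> kT; have : k.+1 * S <= 2 ^ L * S by rewrite leq_mul2r (leq_ltn_trans kT L_above) orbT.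
by rewrite mulSn; move: word_bound; clear; lia.
Qed.

Lemma prep_exec : exists r m t s,
  [/\ exec w (preprocess offline) (off_input w n G us) (r, m) t s,
      t <= prep_cost & ready 0 m].
Proof.
have H := @runs_offline_preprocess directed W A w n N R a b L (lg n) tp tu G us
  n_gt0 isT word_bound L_above L_least (lg_ltn n) (fun j => @lg_least n j n_gt0)
  G_adm us_legal preprocess_regs update_regs preprocess_exec update_exec
  (fun _ m => ready 0 m).
have [|i _|r [m [t [s [l [E tt _ rdy]]]]]] := H _ (cells [:: n; N; size us]).
- by move=> l m m0 m1 hs; split=> //; rewrite mul0n addn0.
- by move: i; do 24! case=> //.
- by exists r, m, t, s.
Qed.

Lemma next_exec k m : ready k m -> k < T ->
  exists m' s, exec w offline_update (cells [::], m) (cells [::], m') 7 s /\ ready k.+1 m'.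
Proof.
move=> [kT m0 m1 hs] kT'.
have fit := slots_fit kT'.
have ev : eval w (cells [::], m) (Bin OpAdd (Peek (Const 0)) (Peek (Const 1))) = X + k.+1 * S.
  have w1 : 1 < 2 ^ w by move: fit; clear; lia.
  rewrite (@eval_value _ _ [::]) //= m0 m1.
    by rewrite mulSn; clear; lia.
  by do ![split]; rewrite ?expn_gt0 //; move: fit; rewrite mulSn; clear; lia.
eexists _, _; split.
  by have := exec_poke w (Const 0) (Bin OpAdd (Peek (Const 0)) (Peek (Const 1))) (cells [::], m); apply.
rewrite ev /= mod0n; split=> //.
move=> q qT; have [vm [vr mv]] := hs q qT; exists vm; split=> // c cS.
by rewrite -mv // /set_cell ifN // /X; clear; lia.
Qed.

(** The query changes only slot [k], whose new content is again reachable for the same graph by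
    [inc_query]. *)
Lemma ask_exec k m u v x y : ready k m -> edge (at_time directed G us k) x y ->
  exists r' m' t s,
    [/\ exec w (offline_query R A) (cells (query_args u v x y), m) (r', m') t s,
        t <= query_cost R tq, ready k m'
      & correct_answer directed w (at_time directed G us k) u v x y r'].
Proof.
move=> [kT m0 m1 hs] exy.
have [vm [vr mv]] := hs k kT.
have [r [vm' [t [s [ex tt ss ans]]]]] := query_exec u v vr exy.
have fit := slots_fit kT.
pose l := [:: nat_of_ord u; nat_of_ord v; nat_of_ord x; nat_of_ord y; m 0].
pose r0 := set_cell (cells (query_args u v x y)) base_reg (m 0).
have r0l i : i < own -> r0 i = nth 0 l i.
  by move=> _; rewrite /r0 /set_cell; move: i; do 6! case=> //.
have [r1 [m' [t' [s' [ex' tt' [ho hr] hin hout]]]]] :=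
  @exec_call w R S (query A) [:: Reg 0; Reg 1; Reg 2; Reg 3] _ _ _ _ _ _ (X + k * S) l m r0
    ex query_regs ss (ltnW fit) m0 mv r0l ltac:(by []) erefl.
have ex0 : exec w (Assign base_reg (Peek (Const 0))) (cells (query_args u v x y), m) (r0, m) 3
    (espan w (cells (query_args u v x y), m) (Peek (Const 0))).
  by have := exec_assign w base_reg (Peek (Const 0)) (cells (query_args u v x y), m);
     rewrite /= mod0n.
eexists _, _, _, _; split.
- apply: exec_seq ex0 _; apply: exec_seq ex' _.
  by apply: exec_seq; exact: exec_assign.
- by move: tt' tt; rewrite /query_cost /call_cost /=; clear; lia.
- split.
  + by [].
  + by rewrite /= hout // /X; clear; lia.
  + by rewrite /= hout // /X; clear; lia.
  + move=> q qT; case: (eqVneq q k) => [->|/eqP qk].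
      by exists vm'; split=> //; exact: inc_query vr exy ex.
    have [vm2 [vr2 mv2]] := hs q qT; exists vm2; split=> // c cS.
    by rewrite /= hout ?mv2 //; apply: slot_disjoint => // E; apply: qk.
- have [d dd an] := ans; exists d => //.
  (* [R] is at least [2] so that the two answer registers are among the mirrored ones. *)
  have h0 := hr 0 (ltnW R_ge2); have h1 := hr 1 R_ge2.
  rewrite addn0 in h0.
  by move: an; rewrite /answers; case: d {dd} => [z|] /=; rewrite /set_cell /= ?h0 ?h1.
Qed.

(** [off_reach] admits any execution; by determinism it is the one constructed above. An update
    costs exactly [7] steps. *)
Lemma off_reach_ready k m tau :
  off_reach directed offline w n G us k m tau -> ready k m /\ tau <= prep_cost + 7 * k.
Proof.
elim=> {k m tau} [r m t s ex|k m tau r m' t s _ [rdy tl] kT ex|k m tau u v x y r m' t s _ [rdy tl] exy ex].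
- have [r1 [m1 [t1 [s1 [ex1 tt1 rdy]]]]] := prep_exec.
  by have [[_ ->] ->] := exec_det ex ex1; rewrite muln0 addn0.
- have [m1 [s1 [ex1 rdy1]]] := next_exec rdy kT.
  have [[_ ->] ->] := exec_det ex ex1; split=> //; move: tl; clear; lia.
- have [r1 [m1 [t1 [s1 [ex1 _ rdy1 _]]]]] := ask_exec u v rdy exy.
  by have [[_ ->] _] := exec_det ex ex1.
Qed.

End Offline.

(** * Bounds depending on [n] alone *)

Lemma offline_preprocess_cost_le R b N N' T T' S K K' L L' l tp tu :
  N <= N' -> T <= T' -> K <= K' -> L <= L' ->
  offline_preprocess_cost R b N T S K L l tp tu <=
  offline_preprocess_cost R b N' T' S K' L' l tp tu.
Proof.
move=> NN TT KK LL; rewrite /offline_preprocess_cost /level_cost /edge_cost /scan_cost.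
by do ![apply: leq_add | apply: leq_mul] => //; rewrite !ltnS.
Qed.

Ltac soft_sum :=
  repeat lazymatch goal with
  | |- soft_poly (fun n => addn (@?f n) (@?g n)) ?k => apply: (@soft_poly_add f g k)
  end;
  try first [exact: soft_poly_lg | exact: soft_poly_const].

Lemma soft_poly_scale c f k : soft_poly f k -> soft_poly (fun n => c * f n) k.
Proof. by apply: (@soft_poly_mul 0 k) => //; exact: soft_poly_const. Qed.

Lemma soft_poly_linear c k : 0 < k -> soft_poly (fun n => c * n) k.
Proof. by move=> k0; apply: soft_poly_scale; exact: soft_poly_id. Qed.

Section Bounds.

Variables (C D R a b : nat) (tp tu : nat -> nat).
Hypothesis tp_soft : soft_poly tp 3.
Hypothesis tu_soft : soft_poly tu 2.

Let slots n := slot_size a b n (lg n).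
Let times n := 2 * (D * n) + 1.

Definition total_cost (n : nat) : nat :=
  offline_preprocess_cost R b (C * n) (D * n) (slots n) (times n)
    (lg n + 2 * D + 1) (lg n) (tp n) (tu n) + 7 * (D * n).

Definition address_bound (n : nat) : nat :=
  2 * (2 * (C * n) * (C * n) + 4 * (D * n) + 2) + times n * slots n + slots n +
  tp n + 4 * times n + 4 + 2 * n.

Let slots_soft : soft_poly slots 2.
Proof.
apply: (@soft_poly_mul 0 2) => //; first exact: soft_poly_lg_exp.
by apply: soft_poly_scale; apply: (@soft_poly_mul 1 1) => //; exact: soft_poly_id.
Qed.

Let times_soft k : 0 < k -> soft_poly times k.
Proof.
by move=> k0; apply: soft_poly_add; [apply: soft_poly_scale; exact: soft_poly_linear|exact: soft_poly_const].
Qed.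

Lemma total_cost_soft : soft_poly total_cost 3.
Proof.
rewrite /total_cost /offline_preprocess_cost /call_cost; soft_sum.
- by apply: soft_poly_scale; soft_sum.
- by apply: soft_poly_scale; exact: soft_poly_lg.
- by apply: soft_poly_scale; apply: (@soft_poly_mul 1 1) => //; exact: soft_poly_linear.
- by apply: soft_poly_scale; exact: soft_poly_linear.
- by apply: soft_poly_scale.
- apply: (@soft_poly_mul 0 3) => //.
    apply: (@soft_poly_le _ (fun n => lg n + 2 * D + 3)); first by move=> n _; clear; lia.
    by soft_sum.
  rewrite /level_cost; soft_sum => //.
  apply: (@soft_poly_mul 1 2) => //; first exact: times_soft.
  soft_sum => //; first exact: soft_poly_scale.
  apply: soft_poly_scale; rewrite /edge_cost /scan_cost /call_cost.
  by soft_sum => //; apply: soft_poly_scale => //; exact: soft_poly_linear.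
- by apply: soft_poly_scale; exact: soft_poly_linear.
Qed.

Lemma address_bound_soft : soft_poly address_bound 3.
Proof.
rewrite /address_bound; soft_sum => //.
- apply: soft_poly_scale; soft_sum => //; last by apply: soft_poly_scale; exact: soft_poly_linear.
  by apply: (@soft_poly_mul 1 1) => //; [apply: soft_poly_scale; exact: soft_poly_linear|exact: soft_poly_linear].
- by apply: (@soft_poly_mul 1 2) => //; exact: times_soft.
- exact: soft_poly_deg slots_soft.
- by apply: soft_poly_scale; exact: times_soft.
- exact: soft_poly_linear.
Qed.

End Bounds.

Theorem theorem11 (directed : bool) (W : pred int) (C D : nat) :
  incremental_oracle directed W C -> offline_oracle directed W C D.
Proof.
case=> A [c0 [sp [tp [tu [tq [[a [b sp_le]] tp_soft tu_soft tq_soft H]]]]]].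
pose R := maxn 2 (maxn (creg (preprocess A)) (maxn (creg (do_update A)) (creg (query A)))).
have [c1 word1] := soft_poly_word (address_bound_soft C D a b tp_soft).
exists (Oracle (offline_preprocess directed R a b A) offline_update (offline_query R A)).
(* Words must be long enough for the incremental oracle, by [c0], and for all addresses used here,
   by [c1]. *)
exists (c0 + c1), (total_cost C D R a b tp tu), (fun n => query_cost R (tq n)); split.
- exact: total_cost_soft.
- have tq0 : soft_poly tq 0 by exact: tq_soft.
  suff : soft_poly (fun n => query_cost R (tq n)) 0 by [].
  rewrite /query_cost /call_cost; soft_sum; try exact: soft_poly_const.
  by apply: (@soft_poly_mul 0 0) => //; exact: soft_poly_const.
move=> n w N G us n0 cw NC TD G_adm us_legal.
have cw0 : c0 * (trunc_log 2 n).+1 <= w.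
  by apply: leq_trans cw; rewrite leq_mul2r leq_addr orbT.
have [preE updE queE] := H n w N n0 cw0 NC.
have [L [LT Lmin]] := least_power (size us).
(* By minimality [2 ^ L] is at most twice the number of updates, or [1] if there are none. *)
have KD : 2 ^ L <= 2 * (D * n) + 1.
  case: L Lmin {LT} => [|L] Lmin; first by rewrite expn0; clear; lia.
  by have := Lmin L (leqnn _); rewrite expnS; move: TD; clear; lia.
(* Otherwise minimality would give [2 ^ (lg n + 2 * D + 1) <= T], whereas [T <= D * n] is smaller,
   as [n < 2 ^ lg n] and [D < 2 ^ (2 * D + 1)]. *)
have LD : L <= lg n + 2 * D + 1.
  rewrite leqNgt; apply/negP => /Lmin; apply/negP; rewrite -ltnNge.
  rewrite -addnA expnD mulnC; apply: leq_ltn_trans TD _; apply: leq_ltn_trans (leq_mul _ (ltnW (lg_ltn n))) _.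
    exact: leq_trans (leq_addr _ _) (leqnn (D + 0)).
  rewrite addn0 ltn_pmul2r ?expn_gt0 //; apply: leq_ltn_trans (ltn_expl _ (isT : 1 < 2)).
  by clear; lia.
have word : 2 * (2 * N * N + 4 * size us + 2) + 2 ^ L * slot_size a b n (lg n) +
    slot_size a b n (lg n) + tp n + 4 * 2 ^ L + 4 + 2 * n < 2 ^ w.
  apply: leq_ltn_trans (_ : _ <= address_bound C D a b tp n) _.
    by do ![apply: leq_add | apply: leq_mul].
  apply: leq_trans (word1 n n0) _; rewrite leq_exp2l //.
  by apply: leq_trans cw; rewrite leq_mul2r leq_addl orbT.
have S_le s : s <= sp n -> s <= slot_size a b n (lg n).
  move=> ss; apply: leq_trans ss _; apply: leq_trans (sp_le n n0) _.
  by rewrite /slot_size mulnC leq_mul2l -mulnn leq_mul2r leqnSn !orbT.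
have [R2 RP RU RQ] : [/\ 2 <= R, creg (preprocess A) <= R, creg (do_update A) <= R
    & creg (query A) <= R].
  by rewrite /R; clear; split; lia.
have updE' (J : wgraph N) m x y z : inc_reach directed W A w n J m ->
    legal directed W w J (Insert x y z) ->
    exists r m' t s, [/\ exec w (do_update A) (cells (insert_args w x y z), m) (r, m') t s,
      t <= tu n & s <= slot_size a b n (lg n)].
  move=> vr leg; have [r [m' [t [s [E tt ss]]]]] := updE J m x y z vr leg.
  by exists r, m', t, s; split=> //; apply: S_le.
have queE' (J : wgraph N) m u v x y : inc_reach directed W A w n J m -> edge J x y ->
    exists r m' t s, [/\ exec w (query A) (cells (query_args u v x y), m) (r, m') t s,
      t <= tq n, s <= slot_size a b n (lg n) & correct_answer directed w J u v x y r].
  move=> vr exy; have [r [m' [t [s [E tt ss ans]]]]] := queE J m u v x y vr exy.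
  by exists r, m', t, s; split=> //; apply: S_le.
have rdy := off_reach_ready n0 word LT Lmin G_adm us_legal R2 RP RU RQ preE updE' queE'.
split.
- have [r [m [t [s [E _ _]]]]] :=
    prep_exec n0 word LT Lmin G_adm us_legal RP RU preE updE'.
  by exists r, m, t, s.
- move=> k m tau /rdy[[kT _ _ _] tl]; apply: leq_trans tl _.
  apply: leq_add; first exact: offline_preprocess_cost_le.
  by rewrite leq_mul2l (leq_trans kT).
- move=> k m tau /rdy[rk _] kT.
  have [m' [s [E _]]] := next_exec word LT rk kT.
  by exists (cells [::]), m', 7, s.
- move=> k m tau u v x y /rdy[rk _] Gk exy.
  have [r [m' [t [s [E tt _ ans]]]]] := ask_exec word LT R2 RQ queE' u v rk exy.
  by exists r, m', t, s.
Qed.
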